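(* Let $d\ge1$, $n\ge d$, and let $(\xi_1,\dots,\xi_n)$ be a symmetrically exchangeable tuple of random vectors in $\mathbb{R}^d$, i.e. $(\xi_1,\dots,\xi_n)\stackrel{d}{=}(\varepsilon_1\xi_{\sigma(1)},\dots,\varepsilon_n\xi_{\sigma(n)})$ for every permutation $\sigma$ of $\{1,\dots,n\}$ and every $\varepsilon_1,\dots,\varepsilon_n\in\{-1,1\}$. Let $S_k=\xi_1+\dots+\xi_k$, $1\le k\le n$, and assume that any $d$ random vectors among $S_1,\dots,S_n$ are linearly independent a.s. Then $$\mathbb{P}[0\in\mathrm{Conv}(S_1,\dots,S_n)]=\frac{2}{2^n n!}\big(B(n,d+1)+B(n,d+3)+\dots\big),$$ where $B(n,k)$ are defined by $(t+1)(t+3)\cdots(t+2n-1)=\sum_{k=0}^nB(n,k)t^k$, with $B(n,k)=0$ for $k\notin\{0,\dots,n\}$.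
   Context: $\mathrm{Conv}$ denotes the convex hull. *)

(* Defs.v *)
From HB Require Import structures.
From mathcomp Require Import all_boot all_order all_algebra all_fingroup.
From mathcomp Require Import all_classical all_reals all_analysis.
Set Implicit Arguments. Unset Strict Implicit. Unset Printing Implicit Defensive.
Import Order.TTheory GRing.Theory Num.Theory.
Local Open Scope classical_set_scope.
Local Open Scope ring_scope.

(* Generators of the product (= Borel) sigma-algebra on (R^d)^n,
   tuples being functions 'I_n -> 'rV[R]_d: cylinder sets on one coordinate. *)
Definition coord_cyl (R : realType) (n d : nat) : set (set ('I_n -> 'rV[R]_d)) :=
  [set A | exists (i : 'I_n) (j : 'I_d) (B : set R),
     measurable B /\ A = [set x : 'I_n -> 'rV[R]_d | B (x i 0 j)]].

Definition same_law (dT : measure_display) (T : measurableType dT) (R : realType)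
    (P : probability T R) (n d : nat) (X Y : 'I_n -> T -> 'rV[R]_d) : Prop :=
  forall A : set ('I_n -> 'rV[R]_d), <<s @coord_cyl R n d>> A ->
    P ((fun w => fun i => X i w) @^-1` A) = P ((fun w => fun i => Y i w) @^-1` A).

Definition sym_exchangeable (dT : measure_display) (T : measurableType dT)
    (R : realType) (P : probability T R) (n d : nat) (xi : 'I_n -> T -> 'rV[R]_d)
    : Prop :=
  forall (s : 'S_n) (b : 'I_n -> bool),
    same_law P xi (fun i w => ((-1) ^+ b i) *: xi (s i) w).

(* partial sums S_{k+1} = xi_1 + ... + xi_{k+1}, indexed by k : 'I_n *)
Definition psum (T : Type) (R : realType) (n d : nat) (xi : 'I_n -> T -> 'rV[R]_d)
    (k : 'I_n) (w : T) : 'rV[R]_d :=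
  \sum_(i < n | (i <= k)%N) xi i w.

Definition in_conv (R : realType) (n d : nat) (p : 'I_n -> 'rV[R]_d) (x : 'rV[R]_d)
    : Prop :=
  exists lam : 'I_n -> R, (forall i, 0 <= lam i) /\ \sum_(i < n) lam i = 1 /\
    \sum_(i < n) lam i *: p i = x.

(* B(n,k) : coefficients of (t+1)(t+3)...(t+2n-1); zero for k > n automatically *)
Definition Bcoef (n k : nat) : int :=
  (\prod_(i < n) ('X + ((2 * i + 1)%N)%:R%:P) : {poly int})`_k.

(* Main.v *)
Require Import Defs.
From HB Require Import structures.
From mathcomp Require Import all_boot all_order all_algebra all_fingroup.
From mathcomp Require Import all_classical all_reals all_analysis.
From mathcomp Require Import measurable_realfun ring lra zify.
Set Implicit Arguments. Unset Strict Implicit. Unset Printing Implicit Defensive.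
Import Order.TTheory GRing.Theory Num.Theory.
Local Open Scope ring_scope.

(** The partial sums of [x_1, ..., x_n] have [0] in their convex hull iff the
    kernel [L = {y | sum_i y_i x_i = 0}] meets the closed Weyl chamber
    [y_1 >= ... >= y_n >= 0] of type B_n outside the origin; for vectors in
    general position it then meets the open chamber.  By exchangeability the
    probability is therefore [1 / (2^n n!)] times the number of open chambers
    met by [L], and this number turns out to be deterministic.

    A k-dimensional face of the arrangement is a signed map from the n indices
    onto k levels; merging the [x_i] of each level turns the question whether
    [L] meets that face into the same question for a walk with k steps.
    Write [b_k] for the chamber count of a k-step walk and [F(n,k)] for the
    number of signed maps onto k levels.  Averaging over the signed
    permutations of the levels, [L] meets [F(n,k) b_k / (2^k k!)] faces of
    dimension k, so Euler's relation in [L] determines [b_n] recursively: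
    [sum_k (-1)^k F(n,k) b_k / (2^k k!) = (-1)^n - (-1)^d].
    That [2 (B(n,d+1) + B(n,d+3) + ...)] solves this recursion follows from
    [t^n = sum_k F(n,k) / (2^k k!) (t-1)(t-3)...(t-2k+1)], which for
    [t = 2m+1] counts the maps from n indices to [{-m, ..., m}] by their set
    of absolute values. *)

(** * Euler's relation for hyperplane arrangements *)

Section Euler.
Variables (R : realFieldType) (n : nat).
Implicit Types (U : 'M[R]_n) (y u : 'rV[R]_n) (a q : 'cV[R]_n) (Q A : seq 'cV[R]_n).

Definition ev a y : R := (y *m a) 0 0.

Lemma evD a y u : ev a (y + u) = ev a y + ev a u.
Proof. by rewrite /ev mulmxDl mxE. Qed.

Lemma evZ a t y : ev a (t *: y) = t * ev a y.
Proof. by rewrite /ev -scalemxAl mxE. Qed.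

Lemma evN a y : ev (- a) y = - ev a y.
Proof. by rewrite /ev mulmxN mxE. Qed.

Lemma sub_ker_ev a y : (y <= kermx a)%MS = (ev a y == 0).
Proof.
apply/sub_kermxP/eqP => [ya0|e]; first by rewrite /ev ya0 mxE.
by apply/rowP => i; rewrite ord1 [RHS]mxE; exact: e.
Qed.

(** Equations are absorbed into the subspace [U] and only strict inequalities into [Q]; a nonempty
    cell is thus a relatively open convex cone of dimension [\rank U]. *)
Definition on_cell U Q y := (y <= U)%MS && all (fun q => 0 < ev q y) Q.

Lemma all_pos_open Q y u : all (fun q => 0 < ev q y) Q ->
  exists2 e : R, 0 < e &
    forall t, `|t| <= e -> all (fun q => 0 < ev q (y + t *: u)) Q.
Proof.
elim: Q => [_|q Q IH] /=; first by exists 1.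
case/andP=> qy /IH [e e0 He].
have m0 : 0 < 1 + `|ev q u| by rewrite ltr_wpDr.
(* The summand 1 avoids a division by zero and leaves a margin of at least [|t|], which keeps the
   inequality strict. *)
pose e' := ev q y / (1 + `|ev q u|).
have e'0 : 0 < e' by rewrite divr_gt0.
exists (Num.min e e'); first by rewrite lt_min e0.
move=> t; rewrite le_min => /andP[te te']; rewrite He // andbT evD evZ.
have : `|t| * (1 + `|ev q u|) <= ev q y by rewrite -ler_pdivlMr.
have [->|tn0] := eqVneq t 0; first by rewrite mul0r addr0.
have tp : 0 < `|t| by rewrite normr_gt0.
have := ler_norm (- (t * ev q u)); rewrite normrN normrM.
by lra.
Qed.

Lemma rank_cap_ker U a :
  \rank (U :&: kermx a)%MS = (\rank U - ~~ (U <= kermx a)%MS)%N.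
Proof.
have := mxrank_mul_ker U a.
have -> : \rank (U *m a) = ~~ (U <= kermx a)%MS :> nat.
  have := rank_leq_col (U *m a).
  have := mxrank_eq0 (U *m a).
  rewrite (sameP eqP sub_kermxP).
  by case: (U <= _)%MS => /eqP; case: (\rank _) => [|[]].
by move=> <-; rewrite addKn.
Qed.

(** If [a] vanishes on [U], the zero slice is the whole cell and both open halves are empty.
    Otherwise the slice has one dimension less and is nonempty exactly when both halves are, so up
    to sign the identity reads 1 = -1 + 1 + 1, or 1 = 0 + 1 with one half empty, or 0 = 0. *)
Lemma euler_step U Q a :
  let X U Q := (`[< exists y, on_cell U Q y >])%:R : int in
  X U Q * (-1) ^+ \rank U =
    X (U :&: kermx a)%MS Q * (-1) ^+ \rank (U :&: kermx a)%MS
    + X U (a :: Q) * (-1) ^+ \rank U + X U (- a :: Q) * (-1) ^+ \rank U.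
Proof.
move=> X; rewrite rank_cap_ker.
have X0P y : on_cell (U :&: kermx a)%MS Q y = (ev a y == 0) && on_cell U Q y.
  by rewrite /on_cell sub_capmx sub_ker_ev andbAC andbC.
have XpP y : on_cell U (a :: Q) y = (0 < ev a y) && on_cell U Q y.
  by rewrite /on_cell /= andbCA.
have XmP y : on_cell U (- a :: Q) y = (ev a y < 0) && on_cell U Q y.
  by rewrite /on_cell /= andbCA evN oppr_gt0.
rewrite /X.
case: (boolP (U <= kermx a)%MS) => Ua.
  have ay0 y : on_cell U Q y -> ev a y = 0.
    by case/andP=> yU _; apply/eqP; rewrite -sub_ker_ev (submx_trans yU).
  rewrite (_ : `[< exists y, on_cell U (a :: Q) y >] = false); last first.
    by apply/asboolPn => -[y]; rewrite XpP => /andP[ay /ay0 e]; rewrite e ltxx in ay.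
  rewrite (_ : `[< exists y, on_cell U (- a :: Q) y >] = false); last first.
    by apply/asboolPn => -[y]; rewrite XmP => /andP[ay /ay0 e]; rewrite e ltxx in ay.
  rewrite !mul0r !addr0 subn0; congr ((nat_of_bool _)%:R * _).
  apply: asbool_equiv_eq; split=> -[y yP]; exists y.
    by rewrite X0P yP (ay0 _ yP) eqxx.
  by move: yP; rewrite X0P => /andP[].
have [u uU ua0] : exists2 u, (u <= U)%MS & ev a u != 0.
  apply: contrapT => H; move/negP: Ua; apply; apply/rV_subP => u uU.
  by rewrite sub_ker_ev; apply: contrapT => /negP e; apply: H; exists u.
have r0 : (0 < \rank U)%N.
  rewrite lt0n mxrank_eq0; apply: contraNneq ua0 => U0.
  by move: uU; rewrite U0 submx0 => /eqP->; rewrite /ev mul0mx mxE.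
have -> : (-1 : int) ^+ \rank U = - (-1) ^+ (\rank U - 1).
  by rewrite -[in LHS](prednK r0) exprS mulN1r subn1.
(* From a point of the wall, small steps along [u] in both directions reach both sides without
   leaving the cell. *)
have p0 : (exists y, on_cell (U :&: kermx a)%MS Q y) ->
    (exists y, on_cell U (a :: Q) y) /\ (exists y, on_cell U (- a :: Q) y).
  case=> y; rewrite X0P => /andP[/eqP ay /andP[yU yQ]].
  have [e e0 He] := all_pos_open u yQ.
  have mem t : ((y + t *: u)%R <= U)%MS by rewrite addmx_sub // scalemx_sub.
  have sm s : `|s| = 1 -> on_cell U Q (y + (s * e) *: u).
    move=> s1; rewrite /on_cell mem He //.
    by rewrite normrM s1 mul1r gtr0_norm.
  have n1 : `|1 : R| = 1 by rewrite normr1.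
  have nn1 : `|-1 : R| = 1 by rewrite normrN normr1.
  case: (ltgtP (ev a u) 0) ua0 => // au _.
    split; [exists (y + (-1 * e) *: u) | exists (y + (1 * e) *: u)].
      by rewrite XpP sm // andbT evD evZ ay; nra.
    by rewrite XmP sm // andbT evD evZ ay; nra.
  split; [exists (y + (1 * e) *: u) | exists (y + (-1 * e) *: u)].
    by rewrite XpP sm // andbT evD evZ ay; nra.
  by rewrite XmP sm // andbT evD evZ ay; nra.
have pm : (exists y, on_cell U (a :: Q) y) -> (exists y, on_cell U (- a :: Q) y) ->
    exists y, on_cell (U :&: kermx a)%MS Q y.
  move=> [y]; rewrite XpP => /andP[ay /andP[yU yQ]].
  move=> [z]; rewrite XmP => /andP[az /andP[zU zQ]].
  (* The positive combination of the two points that lands on the wall; it stays in the cell, which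
     is a convex cone. *)
  exists ((- ev a z) *: y + ev a y *: z); rewrite X0P evD !evZ.
  rewrite mulrC mulrN addrC subrr eqxx /on_cell.
  rewrite (_ : (_ <= U)%MS) /=; last by apply: addmx_sub; exact: scalemx_sub.
  apply/allP => q qQ; rewrite evD !evZ addr_gt0 ?mulr_gt0 ?oppr_gt0 //.
    by have /allP/(_ _ qQ) := yQ.
  by have /allP/(_ _ qQ) := zQ.
have tri : (exists y, on_cell U Q y) <-> (exists y, on_cell (U :&: kermx a)%MS Q y) \/
     (exists y, on_cell U (a :: Q) y) \/ exists y, on_cell U (- a :: Q) y.
  split.
    case=> y yP; case: (ltgtP (ev a y) 0) => ay.
    - by right; right; exists y; rewrite XmP ay.
    - by right; left; exists y; rewrite XpP ay.
    - by left; exists y; rewrite X0P ay eqxx.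
  by case=> [|[]] [y]; rewrite ?X0P ?XpP ?XmP => /andP[_ ?]; exists y.
do 4!case: asboolP => //; rewrite /= ?mul0r ?mul1r; move=> *; try ring;
  exfalso; tauto.
Qed.

(** For [y] in [U], the linear hull of the face through [y] of the arrangement that [A] cuts out in
    [U]. *)
Definition flat U A y : 'M[R]_n :=
  foldl (fun W a => if ev a y == 0 then (W :&: kermx a)%MS else W) U A.

Lemma sub_flat U A y u :
  reflect ((u <= U)%MS /\ forall a, a \in A -> ev a y = 0 -> ev a u = 0)
    (u <= flat U A y)%MS.
Proof.
elim: A U => [|a A IH] U /=; first by apply: (iffP idP) => // -[].
apply: (iffP (IH _)) => -[].
  move=> uU H; split.
    by move: uU; case: ifP => // _; rewrite sub_capmx => /andP[].
  move=> b; rewrite inE => /orP[/eqP->|/H//] ay.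
  by move: uU; rewrite ay eqxx sub_capmx => /andP[_]; rewrite sub_ker_ev => /eqP.
move=> uU H; split; last by move=> b bA; apply: H; rewrite inE bA orbT.
case: eqP => // ay; rewrite sub_capmx uU sub_ker_ev H ?inE ?eqxx //.
Qed.

(* Cutting by one more hyperplane splits a cell either into one cell of the
   same dimension or into two such cells and their common wall, so the
   alternating sum over cells does not change. *)
Lemma euler_cells (K : finType) (Fc : K -> 'rV[R]_n -> Prop) (w : K -> nat)
    A U Q :
  (forall y, on_cell U Q y -> exists f, Fc f y) ->
  (forall f g y, Fc f y -> Fc g y -> f = g) ->
  (forall f y u a, a \in A -> Fc f y -> Fc f u ->
     Num.sg (ev a y) = Num.sg (ev a u)) ->
  (forall f y u, on_cell U Q y -> on_cell U Q u ->
     (forall a, a \in A -> Num.sg (ev a y) = Num.sg (ev a u)) -> Fc f y -> Fc f u) ->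
  (forall f y, on_cell U Q y -> Fc f y -> \rank (flat U A y) = w f) ->
  \sum_(f | `[< exists2 y, on_cell U Q y & Fc f y >]) (-1) ^+ w f =
    (`[< exists y, on_cell U Q y >])%:R * (-1) ^+ \rank U :> int.
Proof.
move=> + Funi; elim: A U Q => [|a A IH] U Q Fex Fsg Fcl Frk.
  case: asboolP => [[y yP]|nex]; last first.
    rewrite big1 ?mul0r // => f /asboolP[y yP _]; case: nex.
    by exists y.
  (* With no hyperplane left to separate its points, the cell lies in a single face. *)
  have [f0 f0P] := Fex y yP.
  rewrite (big_pred1 f0) ?mul1r ?(Frk _ _ yP f0P) // => f.
  apply/asboolP/eqP => [[u uP fu]|->]; last by exists y.
  by apply: (Funi f f0 y) => //; exact: (Fcl f u y uP yP).
have X0P y : on_cell (U :&: kermx a)%MS Q y = (ev a y == 0) && on_cell U Q y.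
  by rewrite /on_cell sub_capmx sub_ker_ev andbAC andbC.
have XpP y : on_cell U (a :: Q) y = (0 < ev a y) && on_cell U Q y.
  by rewrite /on_cell /= andbCA.
have XmP y : on_cell U (- a :: Q) y = (ev a y < 0) && on_cell U Q y.
  by rewrite /on_cell /= andbCA evN oppr_gt0.
have IH' V Q' s : (forall y, on_cell V Q' y ->
      [/\ on_cell U Q y, Num.sg (ev a y) = s & flat U (a :: A) y = flat V A y]) ->
    \sum_(f | `[< exists2 y, on_cell V Q' y & Fc f y >]) (-1) ^+ w f =
    (`[< exists y, on_cell V Q' y >])%:R * (-1) ^+ \rank V :> int.
  move=> H; apply: IH.
  - by move=> y /H[yP _ _]; exact: Fex.
  - by move=> f y u b bA; apply: Fsg; rewrite inE bA orbT.
  - move=> f y u /H[yP ys _] /H[uP us _] Hyu; apply: Fcl => // b.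
    by rewrite inE => /orP[/eqP->|/Hyu//]; rewrite ys us.
  - by move=> f y /H[yP _ <-]; exact: Frk.
rewrite (euler_step _ _ a).
rewrite -(IH' _ _ 0); last first.
  move=> y; rewrite X0P => /andP[/eqP ay ->]; split=> //; first by rewrite ay sgr0.
  by rewrite /= ay eqxx.
rewrite -(IH' _ _ 1); last first.
  move=> y; rewrite XpP => /andP[ay ->]; split=> //; first by rewrite gtr0_sg.
  by rewrite /= gt_eqF.
rewrite -(IH' _ _ (-1)); last first.
  move=> y; rewrite XmP => /andP[ay ->]; split=> //; first by rewrite ltr0_sg.
  by rewrite /= lt_eqF.
rewrite !(big_mkcond (fun f => `[< _ >])) -!big_split /=; apply: eq_bigr => f _.
have sgE y u : Fc f y -> Fc f u -> Num.sg (ev a y) = Num.sg (ev a u).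
  by apply: Fsg; rewrite inE eqxx.
have E0 y : on_cell (U :&: kermx a)%MS Q y <-> on_cell U Q y /\ Num.sg (ev a y) = 0.
  rewrite X0P; split; first by case/andP=> /eqP-> ->; rewrite sgr0.
  by case=> -> /eqP; rewrite sgr_eq0 => ->.
have Ep y : on_cell U (a :: Q) y <-> on_cell U Q y /\ Num.sg (ev a y) = 1.
  rewrite XpP; split; first by case/andP=> ? ->; rewrite gtr0_sg.
  by case=> -> /eqP; rewrite sgr_cp0 => ->.
have Em y : on_cell U (- a :: Q) y <-> on_cell U Q y /\ Num.sg (ev a y) = -1.
  rewrite XmP; split; first by case/andP=> ? ->; rewrite ltr0_sg.
  by case=> -> /eqP; rewrite sgr_cp0 => ->.
have one0 : (1 : R) != 0 by rewrite oner_eq0.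
case: (asboolP (exists2 y, on_cell U Q y & Fc f y)) => [[y yP fy]|nex]; last first.
  do 3!(rewrite [X in if X then _ else _](_ : _ = false) ?addr0 //;
   last by apply/asboolPn => -[y]; rewrite ?(E0, Ep, Em) => -[yP _ fy];
     apply: nex; exists y).
(* The sign of [a] is constant on [f], so [f] meets exactly one of the three pieces of the cell. *)
have Xs V Q' s : (forall u, on_cell V Q' u <-> on_cell U Q u /\ Num.sg (ev a u) = s) ->
    `[< exists2 u, on_cell V Q' u & Fc f u >] = (Num.sg (ev a y) == s).
  move=> H; apply/asboolP/eqP => [[u /H[uP <-] fu]|e]; first exact: sgE.
  by exists y => //; apply/H.
rewrite (Xs _ _ _ E0) (Xs _ _ _ Ep) (Xs _ _ _ Em).
have N1 : (-1 == 1 :> R) = false by apply/eqP; lra.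
case: (sgrP (ev a y)) => _;
  by rewrite ?eqxx ?oppr_eq0 ?oner_eq0 ?[0 == _]eq_sym ?oppr_eq0 ?oner_eq0
     ?N1 ?[1 == -1]eq_sym ?N1 ?addr0 ?add0r.
Qed.

End Euler.

(** * Faces of the reflection arrangement of type B *)

(* [c i = Some (j, e)] puts the index [i] on level [j] with sign [(-1)^e];
   [c i = None] stands for the value 0. *)
Definition smap (n k : nat) := {ffun 'I_n -> option ('I_k * bool)}.

Definition onto (n k : nat) (c : smap n k) :=
  [forall j : 'I_k, exists i, exists e, c i == Some (j, e)].

Lemma ontoP n k (c : smap n k) :
  reflect (forall j, exists i e, c i = Some (j, e)) (onto c).
Proof.
apply: (iffP forallP) => H j.
  by have /existsP[i /existsP[e /eqP ie]] := H j; exists i, e.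
by have [i [e ie]] := H j; apply/existsP; exists i; apply/existsP; exists e; apply/eqP.
Qed.

Definition scomp (n k l : nat) (g : smap k l) (c : smap n k) : smap n l :=
  [ffun i => if c i is Some (j, e) then
               if g j is Some (j', e') then Some (j', e (+) e') else None
             else None].

Lemma onto_scomp n k l (g : smap k l) (c : smap n k) :
  onto g -> onto c -> onto (scomp g c).
Proof.
move=> /ontoP og /ontoP oc; apply/ontoP => j.
have [i [e ie]] := og j; have [i' [e' ie']] := oc i.
by exists i', (e' (+) e); rewrite ffunE ie' ie.
Qed.

Lemma onto_leq n k (c : smap n k) : onto c -> (k <= n)%N.
Proof.
move=> /ontoP oc; have /(_ _)/cid r := oc.
pose r' j := sval (r j).
have r'inj : injective r'.
  move=> j j' e; have [ej ce] := svalP (r j); have [ej' ce'] := svalP (r j').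
  by move: ce; rewrite -/(r' j) e ce' => -[].
by have := leq_card r' r'inj; rewrite !card_ord.
Qed.

(** A choice of preimages is injective, hence a permutation, so no index is left for [None]. The
    onto signed maps on k levels are therefore the signed permutations. *)
Lemma onto_perm k (g : smap k k) : onto g ->
  exists (s : 'S_k) (b : 'I_k -> bool), forall i, g i = Some (s i, b i).
Proof.
move=> /ontoP og; have /(_ _)/cid r := og.
pose r' j := sval (r j).
have r'inj : injective r'.
  move=> j j' e; have [ej ce] := svalP (r j); have [ej' ce'] := svalP (r j').
  by move: ce; rewrite -/(r' j) e ce' => -[].
pose s := (perm r'inj)^-1%g.
have H i : exists e, g i = Some (s i, e).
  have [e ge] := svalP (r (s i)); exists e; rewrite -ge.
  by rewrite -/(r' (s i)) -(permE r'inj) /s permKV.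
have /(_ _)/cid b := H.
by exists s, (fun i => sval (b i)) => i; exact: (svalP (b i)).
Qed.

Section SignedMatrix.
Variable R : realFieldType.

(** It plays two roles: [v *m smx c] spreads level values over the indices with their signs, and
    [smx c *m X] merges the rows of [X] on each level into one signed sum. *)
Definition smx (n k : nat) (c : smap n k) : 'M[R]_(k, n) :=
  \matrix_(j, i) (if c i is Some (j', e) then if j' == j then (-1) ^+ e else 0 else 0).

Lemma mul_smxE n k (c : smap n k) (v : 'rV[R]_k) i :
  (v *m smx c) 0 i = if c i is Some (j, e) then (-1) ^+ e * v 0 j else 0.
Proof.
rewrite mxE; case E: (c i) => [[j e]|]; last first.
  by rewrite big1 // => j _; rewrite mxE E mulr0.
rewrite (bigD1 j) //= big1 ?addr0; first by rewrite mxE E eqxx mulrC.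
by move=> l lj; rewrite mxE E eq_sym (negbTE lj) mulr0.
Qed.

Lemma smx_comp n k l (g : smap k l) (c : smap n k) :
  smx (scomp g c) = smx g *m smx c.
Proof.
apply/row_matrixP => r; rewrite row_mul; apply/rowP => i.
rewrite mul_smxE !mxE ffunE; case: (c i) => [[j e]|] //.
rewrite !mxE; case: (g j) => [[j' e']|]; last by rewrite mulr0.
by case: eqP; rewrite ?mulr0 // signr_addb.
Qed.

Lemma smx_free n k (c : smap n k) : onto c -> row_free (smx c).
Proof.
move=> /ontoP oc; rewrite -kermx_eq0; apply/rowV0P => v /sub_kermxP vc.
apply/rowP => j; have [i [e ie]] := oc j.
have := mul_smxE c v i; rewrite vc ie !mxE => /esym/eqP.
by rewrite mulf_eq0 signr_eq0 => /eqP.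
Qed.

(** The open Weyl chamber of type B_k. *)
Definition decreasing k (v : 'rV[R]_k) :=
  (forall j, 0 < v 0 j) /\ (forall j l : 'I_k, (j < l)%N -> v 0 l < v 0 j).

Lemma decreasing_lt k (v : 'rV[R]_k) j l :
  decreasing v -> (v 0 l < v 0 j) = (j < l)%N.
Proof.
move=> [_ H]; case: (ltngtP j l) => jl; first by rewrite H.
  by apply/negbTE; rewrite -leNgt ltW // H.
by rewrite (val_inj jl : j = l) ltxx.
Qed.

Lemma decreasing_inj k (v : 'rV[R]_k) : decreasing v -> injective (v 0).
Proof.
move=> dv j l e; apply/val_inj; case: (ltngtP j l) => // jl;
  by have [_ /(_ _ _ jl)] := dv; rewrite e ltxx.
Qed.

(** The number of levels is part of the label, so that the faces of all dimensions are indexed by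
    one finite type, as Euler's relation requires. *)
Definition face n (f : {k : 'I_n.+1 & smap n k}) (y : 'rV[R]_n) :=
  onto (tagged f) /\ exists2 v, decreasing v & y = v *m smx (tagged f).

Definition hit k d (Z : 'M[R]_(k, d)) : bool :=
  `[< exists2 v : 'rV_k, decreasing v & v *m Z = 0 >].

Lemma norm_mul_smx n k (c : smap n k) (v : 'rV[R]_k) i : decreasing v ->
  `|(v *m smx c) 0 i| = if c i is Some (j, e) then v 0 j else 0.
Proof.
move=> [v0 _]; rewrite mul_smxE; case: (c i) => [[j e]|]; last by rewrite normr0.
by rewrite normrMsign gtr0_norm.
Qed.

Lemma sg_mul_smx n k (c : smap n k) (v : 'rV[R]_k) i : decreasing v ->
  Num.sg ((v *m smx c) 0 i) = if c i is Some (j, e) then (-1) ^+ e else 0.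
Proof.
move=> [v0 _]; rewrite mul_smxE; case: (c i) => [[j e]|]; last by rewrite sgr0.
by rewrite sgrM sgrX sgrN1 gtr0_sg // mulr1.
Qed.

(** The levels are the distinct nonzero absolute values of the coordinates, in decreasing order. *)
Lemma face_exists n (y : 'rV[R]_n) : exists f, face f y.
Proof.
pose s := rev (sort <=%O (undup [seq `|y 0 i| | i <- enum 'I_n & y 0 i != 0])).
have sn : (size s <= n)%N.
  rewrite size_rev size_sort (leq_trans (size_undup _)) // size_map size_filter.
  by rewrite (leq_trans (count_size _ _)) // size_enum_ord.
have sP x : (x \in s) = [exists i, (y 0 i != 0) && (x == `|y 0 i|)].
  rewrite mem_rev mem_sort mem_undup; apply/mapP/existsP => [[i]|[i /andP[yi /eqP->]]].
    by rewrite mem_filter => /andP[yi _] ->; exists i; rewrite yi eqxx.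
  by exists i => //; rewrite mem_filter yi mem_enum.
have su : uniq s by rewrite rev_uniq sort_uniq undup_uniq.
have ss : sorted >%O s.
  by rewrite rev_sorted lt_sorted_uniq_le sort_le_sorted sort_uniq undup_uniq.
pose k : 'I_n.+1 := Ordinal (sn : (size s < n.+1)%N).
(* For a zero coordinate [index] returns [size s], which [insub] rejects. *)
pose c : smap n k := [ffun i => if insub (index `|y 0 i| s) is Some j
   then Some (j, y 0 i < 0) else None].
exists (Tagged (fun k : 'I_n.+1 => smap n k) c); split=> /=.
  apply/ontoP => j; have : s`_j \in s by rewrite mem_nth.
  rewrite sP => /existsP[i /andP[yi /eqP sj]].
  exists i, (y 0 i < 0); rewrite ffunE -sj index_uniq //.
  by rewrite valK.
exists (\row_j s`_j).
  split=> [j|j l jl]; rewrite !mxE.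
    have : s`_j \in s by rewrite mem_nth.
    by rewrite sP => /existsP[i /andP[yi /eqP->]]; rewrite normr_gt0.
  by have := sorted_ltn_nth (rev_trans lt_trans) 0 ss; apply => //; rewrite inE.
apply/rowP => i; rewrite mul_smxE ffunE.
case: insubP => [j js jE|]; last first.
  rewrite index_mem sP negb_exists => /forallP/(_ i).
  by rewrite eqxx andbT negbK => /eqP.
rewrite mxE jE nth_index; last by rewrite -index_mem.
by rewrite -numEsign.
Qed.

(** The level values form a strictly decreasing list whose elements are the nonzero absolute values
    of [y], so [y] determines it; the absolute value and sign of each coordinate then give back the
    map. *)
Lemma face_uniq n f g (y : 'rV[R]_n) : face f y -> face g y -> f = g.
Proof.
case: f g => [k c] [k' c'] [/= /ontoP oc [v dv yv]] [/= /ontoP oc' [v' dv' yv']].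
pose t l (u : 'rV[R]_l) :=
  mkseq (fun m => if insub m is Some j then u 0 (j : 'I_l) else 0) l.
have E l (b : smap n l) (u : 'rV[R]_l) :
    (forall j, exists i e, b i = Some (j, e)) -> decreasing u -> y = u *m smx b ->
    sorted >%O (t l u) /\
    forall x, (x \in t l u) = [exists i, (y 0 i != 0) && (x == `|y 0 i|)].
  move=> ob du yu.
  have tE (j : 'I_l) : (t l u)`_j = u 0 j by rewrite nth_mkseq // valK.
  split.
    apply/(sortedP 0) => m; rewrite size_mkseq => ml.
    rewrite (tE (Ordinal (ltnW ml))) (tE (Ordinal ml)).
    by rewrite /= (decreasing_lt _ _ du) /=.
  move=> x; apply/(nthP 0)/existsP.
    move=> [m]; rewrite size_mkseq => ml <-; rewrite (tE (Ordinal ml)).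
    have [i [e ie]] := ob (Ordinal ml); exists i.
    rewrite -normr_eq0 yu norm_mul_smx // ie eqxx andbT.
    by rewrite gt_eqF //; case: du.
  move=> [i /andP[]]; rewrite -normr_eq0 yu norm_mul_smx //.
  case: (b i) => [[j e]|]; rewrite ?eqxx // => _ /eqP->.
  by exists j; rewrite ?size_mkseq ?tE.
have [ss sP] := E _ _ _ oc dv yv.
have [ss' sP'] := E _ _ _ oc' dv' yv'.
have ess : t k v = t k' v'.
  apply: (@irr_sorted_eq _ >%O) => //; first exact: rev_trans lt_trans.
    exact: lt_irreflexive.
  by move=> x; rewrite sP sP'.
have ekk : k = k' :> nat by have := congr1 size ess; rewrite !size_mkseq.
have {}ekk : k = k' by apply/val_inj.
subst k'; congr existT.
have ev : v = v'.
  apply/rowP => j; have := congr1 (fun r => nth 0 r j) ess.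
  by rewrite !nth_mkseq // valK.
apply/ffunP => i.
have := norm_mul_smx c i dv; rewrite -yv yv' norm_mul_smx // -ev.
have := sg_mul_smx c i dv; rewrite -yv yv' sg_mul_smx //.
case: (c i) (c' i) => [[j e]|] [[j' e']|] //.
- move=> h /(decreasing_inj dv) ->; congr (Some (_, _)).
  by move: h; case: e e' => [] [] //= /eqP; rewrite ?expr1 ?expr0 -subr_eq0 => /eqP; lra.
- by move/eqP; rewrite eq_sym signr_eq0.
- by move/eqP; rewrite signr_eq0.
Qed.

End SignedMatrix.

(** * Euler's relation for the faces met by the kernel of a generic matrix *)

Section FaceCount.
Variable R : realFieldType.

(** Normals e_i + e_j and e_i - e_j; the case i = j with sign + is 2 e_i and provides the coordinate
    hyperplanes. *)
Definition reflection_col n (p : 'I_n * 'I_n * bool) : 'cV[R]_n :=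
  delta_mx p.1.1 0 + (-1) ^+ p.2 *: delta_mx p.1.2 0.

Definition reflections n : seq 'cV[R]_n :=
  [seq reflection_col p | p <- enum {: 'I_n * 'I_n * bool}].

Lemma ev_reflection n i j b (y : 'rV[R]_n) :
  ev (reflection_col (i, j, b)) y = y 0 i + (-1) ^+ b * y 0 j.
Proof.
by rewrite /ev /reflection_col /= mulmxDr -scalemxAr -!colE !mxE.
Qed.

Lemma mem_reflections n (p : 'I_n * 'I_n * bool) :
  reflection_col p \in reflections n.
Proof. by apply: map_f; rewrite mem_enum. Qed.

Lemma reflectionsP n (Pr : 'cV[R]_n -> Prop) :
  (forall a, a \in reflections n -> Pr a) <->
  (forall i j b, Pr (reflection_col (i, j, b))).
Proof.
split=> [H i j b|H a /mapP[[[i j] b] _ ->] //].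
by apply: H; exact: mem_reflections.
Qed.

Lemma sg_normB (x y : R) :
  Num.sg (`|x| - `|y|) = Num.sg (x - y) * Num.sg (x + y).
Proof.
rewrite -sgrM -subr_sqr -(real_normK (num_real x)) -(real_normK (num_real y)).
rewrite subr_sqr sgrM.
have [n0|n0] := eqVneq (`|x| + `|y|) 0; last first.
  by rewrite (gtr0_sg (x := `|x| + `|y|)) ?mulr1 // lt_def n0 addr_ge0.
move/eqP: n0; rewrite paddr_eq0 // => /andP[/eqP-> /eqP->].
by rewrite subrr sgr0 mul0r.
Qed.

(** The summand of larger absolute value decides the sign of a sum; in a tie the sum vanishes unless
    the signs agree. *)
Lemma sg_add_eq (x y x' y' : R) : Num.sg x = Num.sg x' -> Num.sg y = Num.sg y' ->
  Num.sg (`|x| - `|y|) = Num.sg (`|x'| - `|y'|) -> Num.sg (x + y) = Num.sg (x' + y').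
Proof.
have P (a b : R) : Num.sg (a + b) =
    if Num.sg (`|a| - `|b|) == 1 then Num.sg a else
    if Num.sg (`|a| - `|b|) == -1 then Num.sg b else
    if Num.sg a == Num.sg b then Num.sg a else 0.
  rewrite !sgr_cp0 subr_gt0 subr_lt0.
  case: (ltrgtP `|a| `|b|) => ab.
  - case: (ltrgtP b 0) ab => z0.
    + rewrite (ltr0_norm z0) ltr_norml => /andP[h1 h2].
      by rewrite !ltr0_sg //; lra.
    + rewrite (gtr0_norm z0) ltr_norml => /andP[h1 h2].
      by rewrite !gtr0_sg //; lra.
    + by rewrite z0 normr0 normr_lt0.
  - case: (ltrgtP a 0) ab => z0.
    + rewrite (ltr0_norm z0) ltr_norml => /andP[h1 h2].
      by rewrite !ltr0_sg //; lra.
    + rewrite (gtr0_norm z0) ltr_norml => /andP[h1 h2].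
      by rewrite !gtr0_sg //; lra.
    + by rewrite z0 normr0 normr_lt0.
  move/eqP: ab; rewrite eqr_norm2 => /orP[]/eqP->.
    by rewrite eqxx -mulr2n -mulr_natl sgrM gtr0_sg ?mul1r.
  by rewrite addNr sgr0 sgrN; case: sgrP => _; case: eqP => //; lra.
by move=> h1 h2 h3; rewrite (P x) (P x') h1 h2 h3.
Qed.

Lemma face_sg n f (y u : 'rV[R]_n) a :
  a \in reflections n -> face f y -> face f u -> Num.sg (ev a y) = Num.sg (ev a u).
Proof.
move=> /[swap] -[_ [v dv ->]] /[swap] -[_ [w dw ->]]; move: a.
apply/reflectionsP => i j b; rewrite !ev_reflection; apply: sg_add_eq.
- by rewrite !sg_mul_smx.
- by rewrite !sgrM !sg_mul_smx.
- rewrite !normrMsign !norm_mul_smx //.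
  case: (tagged f i) => [[p e]|]; case: (tagged f j) => [[q e']|] //.
  + case: (ltngtP p q) => pq.
    * by rewrite !gtr0_sg // subr_gt0 decreasing_lt.
    * by rewrite !ltr0_sg // subr_lt0 decreasing_lt.
    * by rewrite (val_inj pq : p = q) !subrr.
  + by rewrite !gtr0_sg // subr0; case: dv; case: dw.
  + by rewrite !ltr0_sg // sub0r oppr_lt0; case: dv; case: dw.
Qed.

(** The forms with i = j give the signs of the coordinates, and the product of the signs of y_i -
    y_j and y_i + y_j gives the order of the absolute values. Together these determine the face. *)
Lemma face_closed n f (y u : 'rV[R]_n) :
  (forall a, a \in reflections n -> Num.sg (ev a y) = Num.sg (ev a u)) ->
  face f y -> face f u.
Proof.
move=> /(reflectionsP (fun a => Num.sg (ev a y) = Num.sg (ev a u))) H.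
have Hs i : Num.sg (y 0 i) = Num.sg (u 0 i).
  have E (x : R) : Num.sg (x + x) = Num.sg x by rewrite -mulr2n sgrMn mul1r.
  by have := H i i false; rewrite !ev_reflection expr0 !mul1r !E.
have Hn i j : Num.sg (`|y 0 i| - `|y 0 j|) = Num.sg (`|u 0 i| - `|u 0 j|).
  have := H i j false; have := H i j true; rewrite !ev_reflection !mul1r !mulN1r.
  by rewrite !sg_normB => -> ->.
case=> oc [v dv yv]; split=> //; move: oc yv.
case: f v dv => -[k kn] c v dv /= /ontoP oc yv.
have /(_ _)/cid r := oc.
have rP j : exists e, c (sval (r j)) = Some (j, e) by exact: (svalP (r j)).
have yr j : `|y 0 (sval (r j))| = v 0 j.
  by have [e ie] := rP j; rewrite yv norm_mul_smx // ie.
exists (\row_j `|u 0 (sval (r j))|).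
  split=> [j|j l jl]; rewrite !mxE.
    rewrite normr_gt0 -sgr_eq0 -Hs sgr_eq0 -normr_gt0 yr; by case: dv.
  rewrite -subr_lt0 -sgr_lt0 -Hn sgr_lt0 subr_lt0 !yr; by case: dv => _; apply.
apply/rowP => i; rewrite mul_smxE.
have := Hs i; rewrite {1}yv sg_mul_smx //.
case ci : (c i) => [[j e]|]; last by move/eqP; rewrite eq_sym sgr_eq0 => /eqP.
rewrite !mxE => se.
have /eqP := Hn i (sval (r j)); rewrite yr {1}yv norm_mul_smx // ci subrr sgr0.
rewrite eq_sym sgr_eq0 subr_eq0 => /eqP <-.
by rewrite [LHS]numEsg -se.
Qed.

(** General position of the kernel of [X] relative to the flats of the arrangement, phrased through
    merged walks so that merging preserves it. *)
Definition generic n d (X : 'M[R]_(n, d)) :=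
  forall k (c : smap n k), (k <= d)%N -> onto c -> row_free (smx R c *m X).

Lemma generic_smx n k d (X : 'M[R]_(n, d)) (c : smap n k) :
  onto c -> generic X -> generic (smx R c *m X).
Proof.
move=> oc gX l g ld og; rewrite mulmxA -smx_comp; apply: gX => //.
exact: onto_scomp.
Qed.

Lemma onto_exists n k : (k <= n)%N -> exists c : smap n k, onto c.
Proof.
move=> kn; exists [ffun i : 'I_n => if insub (i : nat) is Some j then Some (j, false) else None].
apply/ontoP => j; exists (widen_ord kn j), false; rewrite ffunE /=.
by rewrite valK.
Qed.

Lemma generic_rank n d (X : 'M[R]_(n, d)) : generic X -> \rank X = minn n d.
Proof.
move=> gX; apply/eqP; rewrite eqn_leq; apply/andP; split.
  by rewrite leq_min rank_leq_row rank_leq_col.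
have [c oc] := @onto_exists n (minn n d) (geq_minl _ _).
have := gX _ c (geq_minr _ _) oc; rewrite /row_free => /eqP e.
by rewrite -[X in (X <= _)%N]e mxrankM_maxr.
Qed.

(** The reflection equations valid at an interior point of the face say exactly that coordinates on
    one level agree up to the prescribed signs and that those without level vanish. *)
Lemma flat_face n d (X : 'M[R]_(n, d)) k (c : smap n k) v :
  onto c -> decreasing v -> v *m smx R c *m X = 0 ->
  (flat (kermx X) (reflections n) (v *m smx R c) :=: kermx (smx R c *m X) *m smx R c)%MS.
Proof.
move=> /ontoP oc dv yX; apply/eqmxP.
set y := v *m smx R c in yX *.
suff H (u : 'rV_n) : (u <= flat (kermx X) (reflections n) y)%MS =
    (u <= kermx (smx R c *m X) *m smx R c)%MS.
  by apply/andP; split; apply/rV_subP => u; rewrite H.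
apply/sub_flat/submxP => [[/sub_kermxP uX uE]|[w uw]].
  have {}uE : forall i j (b : bool), y 0 i + (-1) ^+ b * y 0 j = 0 ->
      u 0 i + (-1) ^+ b * u 0 j = 0.
    by move=> i j b; have := uE _ (mem_reflections (i, j, b)); rewrite !ev_reflection.
  have [r rP] := choice oc; have [s sP] := choice rP.
  pose w := \row_j ((-1) ^+ (s j) * u 0 (r j)).
  have uw : u = w *m smx R c.
    apply/rowP => i; rewrite mul_smxE.
    case ci : (c i) => [[j e]|]; last first.
      have : y 0 i = 0 by rewrite mul_smxE ci.
      by move=> yi; have := uE i i false; rewrite yi mulr0 addr0 mul1r => /(_ erefl); lra.
    have cr := sP j; rewrite !mxE.
    (* The sign for which the coordinates of [y] at [i] and at the representative [r j] of its level
       cancel. *)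
    have := uE i (r j) (~~ (e (+) s j)).
    rewrite !mul_smxE ci cr mulrA -!signr_addb.
    have -> : ~~ (e (+) s j) (+) s j = ~~ e by case: (e) (s j) => [] [].
    rewrite signrN mulNr subrr => /(_ erefl).
    by rewrite signrN mulNr mulrA -signr_addb => /eqP; rewrite subr_eq0 => /eqP.
  have /submxP[w' ww'] : (w <= kermx (smx R c *m X))%MS.
    by apply/sub_kermxP; rewrite mulmxA -uw.
  by exists w'; rewrite mulmxA -ww'.
split.
  apply/sub_kermxP; rewrite uw -(mulmxA w) -(mulmxA (kermx _)).
  by rewrite mulmx_ker mulmx0.
have {uw} [w' uw] : exists w' : 'rV_k, u = w' *m smx R c.
  by exists (w *m kermx (smx R c *m X)); rewrite uw mulmxA.
apply/reflectionsP => i j b; rewrite !ev_reflection uw !mul_smxE.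
have vp j' : 0 < v 0 j' by case: dv.
have sn (e : bool) x : ((-1) ^+ e * x == 0 :> R) = (x == 0).
  by rewrite mulf_eq0 signr_eq0.
case: (c i) (c j) => [[p e]|] [[q e']|]; rewrite ?mulr0 ?addr0 ?add0r //.
- move=> h; have epq : p = q.
    apply: (decreasing_inj dv); rewrite -(gtr0_norm (vp p)) -(gtr0_norm (vp q)).
    move/eqP: h; rewrite addr_eq0 => /eqP/(congr1 Num.norm).
    by rewrite normrN !normrMsign.
  subst q; move: h; rewrite !mulrA -!mulrDl => /eqP.
  by rewrite mulf_eq0 (gt_eqF (vp p)) orbF => /eqP->; rewrite mul0r.
- by move/eqP; rewrite sn gt_eqF.
- by move/eqP; rewrite !sn gt_eqF.
Qed.

(** The kernel of [X] has dimension n - d and meets a face with k levels in dimension k - min(k, d),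
    which is the truncated difference [k - d]. *)
Lemma face_count n d (X : 'M[R]_(n, d)) : (d <= n)%N -> generic X ->
  \sum_(k < n.+1) \sum_(c : smap n k | onto c)
     (hit (smx R c *m X))%:R * (-1) ^+ (k - d) = (-1) ^+ (n - d) :> int.
Proof.
move=> dn gX.
have cell0 y : on_cell (kermx X) [::] y = (y *m X == 0).
  by rewrite /on_cell andbT; apply/sub_kermxP/eqP.
have := @euler_cells R n {k : 'I_n.+1 & smap n k} (@face R n)
   (fun f => (tag f - d)%N) (reflections n) (kermx X) [::]
   (fun y _ => face_exists y) (@face_uniq R n)
   (fun f y u a => @face_sg n f y u a) (fun f y u _ _ => @face_closed n f y u).
rewrite mxrank_ker (generic_rank gX) (minn_idPr dn).
rewrite (_ : `[< _ >] = true); last first.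
  by apply/asboolP; exists 0; rewrite cell0 mul0mx.
rewrite mul1r => <-; last first.
  move=> [k c] y; rewrite cell0 => /eqP yX [/= oc [v dv yv]].
  move: yX; rewrite yv => yX; rewrite (flat_face oc dv yX).
  rewrite mxrankMfree ?smx_free // mxrank_ker (generic_rank (generic_smx oc gX)).
  by rewrite minnE subKn ?leq_subr // /minn; lia.
rewrite (sig_big_dep _ (fun k c => onto c)) /=.
rewrite big_mkcond [RHS]big_mkcond; apply: eq_bigr => -[k c] _ /=.
rewrite /face /=; case: (boolP (onto c)) => oc; last first.
  by rewrite (_ : `[< _ >] = false) //; apply/asboolPn => -[y _ []].
rewrite (_ : `[< _ >] = hit (smx R c *m X)); first by case: hit; rewrite ?mul1r ?mul0r.
apply: asbool_equiv_eq; split.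
  by case=> y; rewrite cell0 => /eqP yX [_ [v dv yv]]; exists v; rewrite // mulmxA -yv.
case=> v dv; rewrite mulmxA => vX; exists (v *m smx R c); first by rewrite cell0 vX.
by split=> //; exists v.
Qed.

End FaceCount.

(** * Counting the faces *)

(** Divided by 2^k k!, the order of the reflection group B_k, this is the Stirling number of the
    second kind of type B. *)
Definition num_onto n k := #|[pred c : smap n k | onto c]|.

Lemma num_onto_small n k : (n < k)%N -> num_onto n k = 0%N.
Proof.
move=> nk; apply: eq_card0 => c; rewrite inE.
by apply/negbTE; apply: contraL nk => /onto_leq; rewrite -leqNgt.
Qed.

Definition levels n m (c : smap n m) : {set 'I_m} :=
  [set j | [exists i, exists e, c i == Some (j, e)]].

Lemma mem_levels n m (c : smap n m) j :
  reflect (exists i e, c i = Some (j, e)) (j \in levels c).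
Proof.
rewrite inE; apply: (iffP existsP) => -[i].
  by move=> /existsP[e /eqP ie]; exists i, e.
by move=> [e ie]; exists i; apply/existsP; exists e; apply/eqP.
Qed.

Lemma card_levels n m (A : {set 'I_m}) :
  #|[pred c : smap n m | levels c == A]| = num_onto n #|A|.
Proof.
pose h (p : 'I_#|A| * bool) := (enum_val p.1, p.2).
have hinj : injective h by move=> [j e] [j' e'] [/enum_val_inj-> ->].
pose f (c : smap n #|A|) : smap n m := [ffun i => omap h (c i)].
have finj : injective f.
  move=> c c' /ffunP e; apply/ffunP => i; have := e i; rewrite !ffunE.
  exact: inj_omap.
have -> : num_onto n #|A| = #|f @: [set c | onto c]| by rewrite card_imset // cardsE.
apply: eq_card => c; rewrite inE.
apply/eqP/imsetP => [lc|[c']]; last rewrite inE => /ontoP oc' ->.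
  have /choice[g gP] : forall i, exists o, omap h o = c i.
    move=> i; case ci : (c i) => [[j e]|]; last by exists None.
    have jA : j \in A by rewrite -lc; apply/mem_levels; exists i, e.
    by exists (Some (enum_rank_in jA j, e)); rewrite /= /h /= enum_rankK_in.
  exists (finfun g); last by apply/ffunP => i; rewrite !ffunE.
  rewrite inE; apply/ontoP => j; have := enum_valP j; rewrite -{2}lc => /mem_levels[i [e ci]].
  exists i, e; rewrite ffunE; have := gP i; rewrite ci.
  by case: (g i) => // -[j' e'] [/enum_val_inj-> ->].
apply/setP => j; apply/mem_levels/idP => [[i [e]]|jA].
  rewrite ffunE; case: (c' i) => [[j' e']|] //= [<- _]; exact: enum_valP.
have [i [e ci]] := oc' (enum_rank_in jA j).
by exists i, e; rewrite ffunE ci /= /h /= enum_rankK_in.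
Qed.

Lemma sum_num_onto n m :
  ((2 * m + 1) ^ n = \sum_(k < n.+1) 'C(m, k) * num_onto n k)%N.
Proof.
have -> : ((2 * m + 1) ^ n = \sum_(A : {set 'I_m}) num_onto n #|A|)%N.
  transitivity #|{: smap n m}|.
    by rewrite card_ffun card_option card_prod card_bool !card_ord mulnC addn1.
  rewrite -sum1_card (partition_big (@levels n m) predT) //=.
  apply: eq_bigr => A _; rewrite -card_levels -sum1_card.
  by apply: eq_bigl => c; rewrite inE.
rewrite (partition_big (fun A : {set 'I_m} => inord #|A| : 'I_m.+1) predT) //=.
have -> : (\sum_(j < m.+1) \sum_(A : {set 'I_m} | inord #|A| == j) num_onto n #|A| =
    \sum_(k < m.+1) 'C(m, k) * num_onto n k)%N.
  apply: eq_bigr => k _.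
  have cA (A : {set 'I_m}) : (inord #|A| == k) = (#|A| == k).
    rewrite -val_eqE /= inordK // ltnS.
    by rewrite -[m in X in (_ <= X)%N]card_ord max_card.
  rewrite (eq_bigr (fun=> num_onto n k)); last by move=> A; rewrite cA => /eqP->.
  rewrite big_const iter_addn_0 mulnC; congr (_ * _)%N.
  have := card_draws 'I_m k; rewrite card_ord => <-; apply: eq_card => A.
  by rewrite !inE -cA.
(* Both ranges are extended to a common one: the binomial vanishes for k > m and [num_onto] for k >
   n. *)
rewrite (big_ord_widen (n + m).+1 (fun k => 'C(m, k) * num_onto n k)%N); last first.
  by rewrite ltnS leq_addl.
rewrite (big_ord_widen (n + m).+1 (fun k => 'C(m, k) * num_onto n k)%N); last first.
  by rewrite ltnS leq_addr.
rewrite !(big_mkcond (fun k : 'I_ _ => k < _.+1)%N); apply: eq_bigr => k _.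
rewrite !ltnS; case: leqP => km; case: leqP => kn //.
  by rewrite num_onto_small // muln0.
by rewrite bin_small.
Qed.

(** * Type B Stirling numbers and the coefficients B(n,k) *)

Definition refl_order k : rat := (2 ^ k * k`!)%:R.

Lemma refl_order_neq0 k : refl_order k != 0.
Proof. by rewrite pnatr_eq0 muln_eq0 expn_eq0 /= -lt0n fact_gt0. Qed.

(** Each factor is 2 (m - i), so the product is 2^k m (m-1) ... (m-k+1); for k > m both sides
    vanish. *)
Lemma prod_odd_shift m k :
  \prod_(i < k) ((2 * m + 1)%:R - (2 * i + 1)%:R) = refl_order k * 'C(m, k)%:R.
Proof.
rewrite /refl_order -natrM -mulnA [(_`! * _)%N]mulnC bin_ffact.
elim: k => [|k IH]; first by rewrite big_ord0 expn0 ffactn0.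
rewrite big_ord_recr /= IH expnS ffactnSr.
case: (leqP k m) => [km|mk].
  by rewrite -natrB ?leq_add2r ?leq_mul2l ?km // subnDr -mulnBr -natrM; congr _%:R; ring.
by rewrite ffact_small // mul0n !muln0 mul0r.
Qed.

(** By [sum_num_onto] both sides agree at every odd number 2m+1, and the difference then has as many
    roots as its size. *)
Lemma expX_prod_odd n : 'X^n = \sum_(k < n.+1)
  ((num_onto n k)%:R / refl_order k) *: \prod_(i < k) ('X - ((2 * i + 1)%N)%:R%:P)
  :> {poly rat}.
Proof.
apply/eqP; rewrite -subr_eq0; apply/eqP; set p := _ - _.
apply: (@roots_geq_poly_eq0 _ p [seq (2 * m + 1)%:R | m <- iota 0 (size p)]).
- apply/allP => _ /mapP[m _ ->]; rewrite rootE /p hornerD hornerN hornerXn horner_sum.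
  rewrite -natrX sum_num_onto natr_sum -sumrB big1 // => k _.
  rewrite hornerZ horner_prod.
  under eq_bigr => i _ do rewrite hornerXsubC.
  rewrite prod_odd_shift mulrA divfK ?refl_order_neq0 //.
  by rewrite natrM mulrC subrr.
- rewrite map_inj_uniq ?iota_uniq // => m m' /eqP; rewrite eqr_nat => /eqP; lia.
- by rewrite size_map size_iota.
Qed.

Lemma Bcoef_ratE k j :
  (Bcoef k j)%:~R = (\prod_(i < k) ('X + ((2 * i + 1)%N)%:R%:P) : {poly rat})`_j.
Proof.
rewrite /Bcoef -coef_map rmorph_prod /=; congr ((polyseq _)`_ _); apply: eq_bigr => i _.
by rewrite rmorphD /= map_polyX map_polyC /= rmorph_nat.
Qed.

Lemma prod_odd_size k :
  size (\prod_(i < k) ('X + ((2 * i + 1)%N)%:R%:P) : {poly rat}) = k.+1.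
Proof.
under eq_bigr => i _ do rewrite -[_%:P]opprK -polyCN.
by rewrite size_prod_XsubC [index_enum _]unlock -enumT size_enum_ord.
Qed.

Lemma Bcoef_small k j : (k < j)%N -> Bcoef k j = 0.
Proof.
move=> kj; apply: (@intr_inj rat); rewrite Bcoef_ratE nth_default //.
by rewrite prod_odd_size.
Qed.

Lemma Bcoef_diag k : Bcoef k k = 1.
Proof.
apply: (@intr_inj rat); rewrite Bcoef_ratE.
have := monic_prod_XsubC (index_enum 'I_k) predT (fun i : 'I_k => - (2 * i + 1)%:R : rat).
under eq_bigr => i _ do rewrite polyCN opprK.
by rewrite monicE lead_coefE prod_odd_size => /eqP.
Qed.

(** Substituting -t for t in [expX_prod_odd] turns (t-1)(t-3)... into (-1)^k (t+1)(t+3)...; the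
    coefficients of t^j are then compared. *)
Lemma sum_num_onto_Bcoef n j :
  \sum_(k < n.+1) (num_onto n k)%:R / refl_order k * (-1) ^+ k * (Bcoef k j)%:~R
  = (-1) ^+ n *+ (j == n) :> rat.
Proof.
have sgC k : (-1) ^+ k = ((-1) ^+ k)%:P :> {poly rat} by rewrite rmorphXn rmorphN1.
have := congr1 (fun p => (p \Po (- 'X))`_j) (expX_prod_odd n).
rewrite /= comp_Xn_poly (exprNn 'X) sgC coefCM coefXn => e.
rewrite -mulr_natr e linear_sum /= coef_sum; apply: eq_bigr => k _.
rewrite comp_polyZ coefZ -mulrA; congr (_ * _); rewrite Bcoef_ratE.
rewrite rmorph_prod /=.
under [in RHS]eq_bigr => i _ do rewrite comp_polyB comp_polyX comp_polyC -opprD.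
by rewrite prodrN card_ord sgC coefCM.
Qed.

Definition tail_Bcoef d n : int :=
  2 * \sum_(k < n.+1 | (d < k)%N && odd (k - d)) Bcoef n k.

Lemma tail_Bcoef_small d n : (n <= d)%N -> tail_Bcoef d n = 0.
Proof.
move=> nd; rewrite /tail_Bcoef big1 ?mulr0 // => k /andP[dk _].
by have := leq_trans (leq_trans dk (ltn_ord k : (k <= n)%N)) nd; rewrite ltnn.
Qed.

(** Only the summand k = n reaches degree n in [sum_num_onto_Bcoef], which counts the signed
    permutations with no further enumeration. *)
Lemma num_onto_diag n : (num_onto n n)%:R = refl_order n.
Proof.
have := sum_num_onto_Bcoef n n; rewrite big_ord_recr /= big1 => [|k _]; last first.
  by rewrite Bcoef_small // mulr0.
rewrite add0r Bcoef_diag mulr1 eqxx mulr1n -[RHS]mul1r => /mulIf.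
rewrite signr_eq0 => /(_ isT) /(canRL (divfK (refl_order_neq0 n))).
by rewrite mul1r.
Qed.

(** Summing [sum_num_onto_Bcoef] over j = d+1, d+3, ... leaves at most j = n, which contributes 2
    (-1)^n exactly when n - d is odd. *)
Lemma sum_num_onto_tail d n : (d <= n)%N ->
  \sum_(k < n.+1) (num_onto n k)%:R / refl_order k * (-1) ^+ k * (tail_Bcoef d k)%:~R
  = (-1) ^+ n - (-1) ^+ d :> rat.
Proof.
move=> dn.
transitivity (\sum_(j < n.+1 | (d < j)%N && odd (j - d))
    2 * ((-1) ^+ n *+ (j == n :> nat)) : rat).
  under [RHS]eq_bigr => j _ do rewrite -sum_num_onto_Bcoef mulr_sumr.
  rewrite exchange_big; apply: eq_bigr => k _ /=.
  rewrite /tail_Bcoef rmorphM /= rmorph_sum /=.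
  rewrite (big_ord_widen_cond n.+1 (fun j => (d < j)%N && odd (j - d))
     (fun j => (Bcoef k j)%:~R : rat)) //.
  rewrite mulrCA !mulr_sumr big_mkcondr; apply: eq_bigr => j _.
  rewrite ltnS; case: leqP => // kj.
  by rewrite Bcoef_small // !mulr0.
rewrite big_mkcond big_ord_recr /= big1 ?add0r => [|j _]; last first.
  by rewrite (ltn_eqF (ltn_ord j)) mulr0 if_same.
rewrite eqxx mulr1n oddB //.
have [dn'|nd] := ltnP d n; last first.
  by rewrite (_ : d = n) ?subrr //; apply/eqP; rewrite eqn_leq dn.
rewrite -signr_odd -[(-1) ^+ d]signr_odd.
by case: (odd n) (odd d) => [] []; rewrite ?expr0 ?expr1 /=; ring.
Qed.

(** * The number of chambers met by the kernel *)

Section HitCount.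
Variable R : realFieldType.

Lemma scomp_inj n k (g : smap k k) : onto g -> injective (@scomp n k k g).
Proof.
move=> /onto_perm[s [b gE]] c c' /ffunP e; apply/ffunP => i.
have := e i; rewrite !ffunE.
case: (c i) (c' i) => [[j a]|] [[j' a']|]; rewrite ?gE //.
case=> /perm_inj-> h; congr (Some (_, _)).
by move: h; case: (b j') a a' => [] [] [].
Qed.

Lemma onto_scompE n k (g : smap k k) (c : smap n k) :
  onto g -> onto (scomp g c) = onto c.
Proof.
move=> og; apply/idP/idP; last exact: onto_scomp.
have [s [b gE]] := onto_perm og; move=> /ontoP H; apply/ontoP => j.
have [i [e]] := H (s j); rewrite ffunE.
case ci : (c i) => [[j' e']|] //; rewrite gE => -[/perm_inj jj _].
by exists i, e'; rewrite ci jj.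
Qed.

Definition num_hit n k d (X : 'M[R]_(n, d)) : int :=
  \sum_(c : smap n k | onto c) (hit (smx R c *m X))%:R.

(* Averaging over the signed permutations of the k levels of a face. *)
Lemma num_hit_average n k d (X : 'M[R]_(n, d)) (b : int) :
  (forall c : smap n k, onto c -> num_hit k (smx R c *m X) = b) ->
  (num_onto k k)%:R * num_hit k X = (num_onto n k)%:R * b.
Proof.
move=> H.
have -> : (num_onto k k)%:R * num_hit k X =
    \sum_(g : smap k k | onto g) \sum_(c : smap n k | onto c)
      (hit (smx R g *m (smx R c *m X)))%:R.
  rewrite (eq_bigr (fun=> num_hit k X)); first by rewrite sumr_const mulr_natl.
  (* Composition with [g] permutes the maps onto k levels, so every [g] gives the same sum. After
     the exchange below, the sum over [g] for fixed [c] is the chamber count of one merged walk. *)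
  move=> g og; rewrite /num_hit [RHS](reindex_inj (scomp_inj (n := n) og)).
  apply: eq_big => c; first by rewrite onto_scompE.
  by rewrite smx_comp mulmxA.
rewrite exchange_big /= (eq_bigr (fun=> b)) => [|c /H //].
by rewrite sumr_const mulr_natl.
Qed.

(** This is the face {0}, met by every kernel. The closed form [tail_Bcoef d 0] is 0 instead, hence
    the positivity assumption in [num_hitE]. *)
Lemma num_hit0 n d (X : 'M[R]_(n, d)) : num_hit 0 X = 1.
Proof.
pose c0 : smap n 0 := [ffun=> None].
rewrite /num_hit (big_pred1 c0) => [|c].
  rewrite (_ : hit _ = true) //; apply/asboolP.
  exists 0; last by rewrite mul0mx.
  by split=> [[m lt0]|[m lt0]]; move: (lt0).
apply/idP/eqP => [_|->]; last by apply/ontoP => -[].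
by apply/ffunP => i; rewrite ffunE; case: (c i) => [[[]]|].
Qed.

Lemma num_hit_small n k d (X : 'M[R]_(n, d)) :
  (0 < k <= d)%N -> generic X -> num_hit k X = 0.
Proof.
case/andP=> k0 kd gX; rewrite /num_hit big1 // => c oc.
rewrite (_ : hit _ = false) //; apply/asboolPn => -[v [v0 _] /eqP].
rewrite (mulmx_free_eq0 _ (gX _ _ kd oc)) => /eqP vE.
by have := v0 (Ordinal k0); rewrite vE mxE ltxx.
Qed.

(** By strong induction and averaging, the terms with k < n in [face_count] are those of
    [sum_num_onto_tail] up to the factor (-1)^d and the correction at k = 0; comparing the two
    relations isolates k = n. *)
Lemma num_hitE n d (X : 'M[R]_(n, d)) :
  (0 < n)%N -> generic X -> num_hit n X = tail_Bcoef d n.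
Proof.
elim/ltn_ind: n X => n IH X n0 gX.
have [nd|dn] := leqP n d.
  by rewrite num_hit_small ?n0 // tail_Bcoef_small.
apply: (@intr_inj rat).
(* The subtracted (-1)^d at k = 0 accounts for the origin, which is counted by [num_hit] but not by
   [tail_Bcoef]. *)
have term (k : 'I_n) : (num_onto n k)%:R / refl_order k * (-1) ^+ k * (tail_Bcoef d k)%:~R
    = (-1) ^+ d * (num_hit k X * (-1) ^+ (k - d))%:~R - (-1) ^+ d *+ (k == 0%N :> nat) :> rat.
  have [k0|k0] := posnP k.
    by rewrite k0 num_hit0 tail_Bcoef_small // mulr0 sub0n expr0 mul1r mulr1 subrr.
  rewrite mulr0n subr0.
  have -> : (num_onto n k)%:R / refl_order k * (-1) ^+ k * (tail_Bcoef d k)%:~R =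
      (-1) ^+ k * (num_hit k X)%:~R :> rat.
    have := @num_hit_average n k d X (tail_Bcoef d k).
    move=> /(_ (fun c oc => IH k (ltn_ord k) _ k0 (generic_smx oc gX))).
    move=> /(congr1 (fun z : int => z%:~R : rat)); rewrite !rmorphM /= !rmorph_nat num_onto_diag.
    move=> e; rewrite mulrAC [_ / _ * _]mulrAC -e [_ * (num_hit _ _)%:~R]mulrC mulfK ?refl_order_neq0 //.
    by rewrite mulrC.
  have [kd|dk] := leqP k d; first by rewrite num_hit_small ?k0 // mul0r !mulr0.
  rewrite rmorphM /= rmorph_sign mulrCA mulrC; congr (_ * _).
  by rewrite -exprD subnKC // ltnW.
have := face_count (ltnW dn) gX.
move=> /(congr1 (fun z : int => z%:~R : rat)); rewrite rmorph_sign rmorph_sum /=.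
have := sum_num_onto_tail (ltnW dn).
rewrite !big_ord_recr /= num_onto_diag divff ?refl_order_neq0 // mul1r.
rewrite (eq_bigr _ (fun k _ => term k)) sumrB -mulr_sumr.
have -> : \sum_(i < n) (-1) ^+ d *+ (i == 0%N :> nat) = (-1) ^+ d :> rat.
  rewrite (bigD1 (Ordinal n0)) //= big1 ?addr0 // => i; rewrite -val_eqE /=.
  by move/negbTE->.
have -> : \sum_(i < n) (\sum_(c : smap n i | onto c)
     (hit (smx R c *m X))%:R * (-1) ^+ (i - d))%:~R =
    \sum_(i < n) (num_hit i X * (-1) ^+ (i - d))%:~R :> rat.
  by apply: eq_bigr => i _; rewrite -mulr_suml.
rewrite -mulr_suml -/(num_hit n X) => h1 h2.
have e : (-1) ^+ n = (-1) ^+ d * (-1) ^+ (n - d) :> rat by rewrite -exprD subnKC // ltnW.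
have eI : (num_hit n X * (-1) ^+ (n - d))%:~R = (num_hit n X)%:~R * (-1) ^+ (n - d) :> rat.
  by rewrite rmorphM rmorph_sign.
move: h1 h2; set S := \sum_(i < n) _; rewrite eI e.
have : (-1) ^+ d != 0 :> rat by rewrite signr_eq0.
have : (-1) ^+ (n - d) != 0 :> rat by rewrite signr_eq0.
set x := (-1) ^+ d; set z := (-1) ^+ (n - d); set a := _%:~R; set t := _%:~R.
move=> z0 x0 h1 h2; apply: (mulfI (mulf_neq0 x0 z0)).
have : x * (S + t * z) = x * z by rewrite h2.
by move=> h3; lra.
Qed.

End HitCount.

(** * Walks in general position *)

Lemma subset_of_card (T : finType) (A : {set T}) m : (m <= #|A|)%N ->
  exists2 B : {set T}, B \subset A & #|B| = m.
Proof.
move=> mA; exists [set x in take m (enum A)].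
  by apply/fintype.subsetP => x; rewrite inE => /mem_take; rewrite mem_enum.
rewrite cardsE; have /card_uniqP-> : uniq (take m (enum A)) by rewrite take_uniq ?enum_uniq.
by rewrite size_take -cardE; case: ltngtP mA.
Qed.

Lemma superset_of_card (T : finType) (A : {set T}) m : (#|A| <= m <= #|T|)%N ->
  exists2 B : {set T}, A \subset B & #|B| = m.
Proof.
case/andP=> Am mT; have [|C CA cC] := @subset_of_card T (~: A) (m - #|A|).
  by rewrite leq_subLR cardsC.
exists (A :|: C); first exact: finset.subsetUl.
rewrite cardsU cC (_ : A :&: C = finset.set0) ?cards0 ?subn0 ?subnKC //.
by apply/eqP; rewrite finset.setI_eq0 disjoint_sym finset.disjoints_subset.
Qed.

Section Walks.
Variable R : realFieldType.

Definition sum_mx n : 'M[R]_n := \matrix_(i, j) (j <= i)%N%:R.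

Lemma mul_sum_smxE n k (c : smap n k) l i : (sum_mx k *m smx R c) l i =
  if c i is Some (j, e) then (j <= l)%N%:R * (-1) ^+ e else 0.
Proof.
transitivity ((row l (sum_mx k) *m smx R c) 0 i); first by rewrite -row_mul [RHS]mxE.
by rewrite mul_smxE; case: (c i) => [[j e]|//]; rewrite !mxE mulrC.
Qed.

Lemma mul_row_sumE n (lam : 'rV[R]_n) j :
  (lam *m sum_mx n) 0 j = \sum_(i < n | (j <= i)%N) lam 0 i.
Proof.
rewrite mxE [RHS]big_mkcond; apply: eq_bigr => i _.
by rewrite mxE; case: leqP; rewrite ?mulr1 ?mulr0.
Qed.

(** Summation by parts: the weights on the partial sums are the successive differences of [v], and
    [v] is recovered from their tail sums. *)
Lemma hitP k d (Z : 'M[R]_(k, d)) :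
  reflect (exists2 lam : 'rV_k, (forall j, 0 < lam 0 j) & lam *m (sum_mx k *m Z) = 0)
    (hit Z).
Proof.
apply: (iffP (asboolP _)) => -[].
  move=> v [v0 dv] vZ.
  (* Extending [v] by 0 makes the last weight equal to the last entry of [v]. *)
  pose v' m := if insub m is Some j then v 0 (j : 'I_k) else 0.
  have v'E (j : 'I_k) : v' j = v 0 j by rewrite /v' valK.
  exists (\row_j (v' j - v' j.+1)).
    move=> j; rewrite mxE subr_gt0 v'E /v'; case: insubP => [l _ lE|_]; last exact: v0.
    by apply: dv; rewrite lE.
  rewrite mulmxA -[RHS]vZ; congr (_ *m _); apply/rowP => j.
  rewrite mul_row_sumE.
  under eq_bigr => i _ do rewrite mxE.
  rewrite -(big_geq_mkord _ _ xpredT (fun i => v' i - v' i.+1)).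
  under eq_bigr => i _ do rewrite -opprB.
  rewrite sumrN telescope_sumr ?(ltnW (ltn_ord j)) // opprB v'E.
  by rewrite /v' insubN ?subr0 // ltnn.
move=> lam lam0; rewrite mulmxA => lZ; exists (lam *m sum_mx k) => //; split.
  move=> j; rewrite mul_row_sumE (bigD1 j) //= ltr_wpDr // sumr_ge0 // => i _.
  exact: ltW.
move=> j l jl; rewrite !mul_row_sumE [ltRHS](bigD1 j) //=.
rewrite ltr_pwDl // (@big_mkcond _ _ _ _ _ (fun i : 'I_k => (l <= i)%N)).
rewrite [leRHS]big_mkcond; apply: ler_sum => i _.
case: (leqP l i) => li; last by case: ifP => // _; exact: ltW.
by rewrite (leq_trans (ltnW jl) li) -val_eqE /= gtn_eqF // (leq_trans jl).
Qed.

Definition supp n (v : 'rV[R]_n) : {set 'I_n} := [set i | v 0 i != 0].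

(* Any [d] of the partial sums of the rows are linearly independent. *)
Definition walk_generic n d (X : 'M[R]_(n, d)) :=
  forall v : 'rV_n, (#|supp v| <= d)%N -> v *m (sum_mx n *m X) = 0 -> v = 0.

Definition sel_mx n k (f : 'I_k -> 'I_n) : 'M[R]_(k, n) := rowsub f 1%:M.

Lemma mul_sel_mxE n k (f : 'I_k -> 'I_n) (u : 'rV[R]_k) j :
  injective f -> (u *m sel_mx f) 0 (f j) = u 0 j.
Proof.
move=> finj; rewrite mxE (bigD1 j) //= big1 ?addr0 => [|i ij].
  by rewrite !mxE eqxx mulr1.
by rewrite !mxE (inj_eq finj) (negbTE ij) mulr0.
Qed.

Lemma mul_sel_mx0 n k (f : 'I_k -> 'I_n) (u : 'rV[R]_k) i :
  (forall j, f j != i) -> (u *m sel_mx f) 0 i = 0.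
Proof. by move=> H; rewrite mxE big1 // => j _; rewrite !mxE (negbTE (H j)) mulr0. Qed.

Lemma supp_sel n k (f : 'I_k -> 'I_n) (u : 'rV[R]_k) :
  supp (u *m sel_mx f) \subset f @: 'I_k.
Proof.
apply/fintype.subsetP => i; rewrite inE; apply: contraNT => iN; apply/eqP/mul_sel_mx0.
by move=> j; apply: contraNneq iN => <-; apply: imset_f.
Qed.

Lemma mul_sel n k m (f : 'I_k -> 'I_n) (M : 'M[R]_(n, m)) : sel_mx f *m M = rowsub f M.
Proof. by rewrite mul_rowsub_mx mul1mx. Qed.

Lemma walk_generic_rowsub n d (X : 'M[R]_(n, d)) k (f : 'I_k -> 'I_n) :
  (k <= d)%N -> injective f -> walk_generic X -> row_free (rowsub f (sum_mx n *m X)).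
Proof.
move=> kd finj wX; rewrite -kermx_eq0; apply/rowV0P => u /sub_kermxP.
rewrite -mul_sel (mulmxA u) => uX.
have u0 : u *m sel_mx f = 0.
  apply: wX uX; apply: leq_trans (subset_leq_card (supp_sel f u)) _.
  by rewrite (leq_trans (leq_imset_card _ _)) // card_ord.
by apply/rowP => j; rewrite -(mul_sel_mxE u j finj) u0 !mxE.
Qed.

(** The hypothesis concerns exactly d rows, so a smaller support is first enlarged to d indices. *)
Lemma walk_genericI n d (X : 'M[R]_(n, d)) : (d <= n)%N ->
  (forall f : 'I_d -> 'I_n, injective f -> row_free (rowsub f (sum_mx n *m X))) ->
  walk_generic X.
Proof.
move=> dn H v sv vX.
have [|B sB cB] := @superset_of_card _ (supp v) d; first by rewrite sv card_ord.
pose f (j : 'I_d) : 'I_n := enum_val (cast_ord (esym cB) j).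
have finj : injective f by move=> i j /enum_val_inj/cast_ord_inj.
have fB i : i \in B -> exists j, i = f j.
  move=> iB; exists (cast_ord cB (enum_rank_in iB i)).
  by rewrite /f cast_ordK enum_rankK_in.
pose u := \row_j v 0 (f j).
have vu : v = u *m sel_mx f.
  apply/rowP => i; have [/fB[j ->]|iB] := boolP (i \in B).
    by rewrite mul_sel_mxE // mxE.
  rewrite mul_sel_mx0 => [|j]; last by apply: contraNneq iB => <-; exact: enum_valP.
  by apply/eqP; apply: contraNT iB => vi; rewrite (fintype.subsetP sB) // inE.
have : u *m rowsub f (sum_mx n *m X) = 0 by rewrite -mul_sel (mulmxA u) -vu.
by move/eqP; rewrite (mulmx_free_eq0 _ (H f finj)) vu => /eqP->; rewrite mul0mx.
Qed.

(** This passes from the closed chamber to the open one. General position forces more than d nonzero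
    weights; d of the corresponding sums form a basis, which yields a linear relation equal to 1 at
    every zero weight, and a small multiple of it is added. *)
Lemma conv_hit n d (X : 'M[R]_(n, d)) : (0 < n)%N -> walk_generic X ->
  (exists lam : 'rV_n, [/\ forall i, 0 <= lam 0 i, \sum_i lam 0 i = 1 &
     lam *m (sum_mx n *m X) = 0]) <-> hit X.
Proof.
move=> n0 wX; set S := sum_mx n *m X; split; last first.
  move=> /hitP[lam lam0 lamX]; have s0 : 0 < \sum_i lam 0 i.
    rewrite (bigD1 (Ordinal n0)) //= ltr_wpDr // sumr_ge0 // => i _; exact: ltW.
  exists ((\sum_i lam 0 i)^-1 *: lam); split.
  - by move=> i; rewrite mxE mulr_ge0 ?invr_ge0 ?ltW.
  - under eq_bigr => i _ do rewrite mxE.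
    by rewrite -mulr_sumr mulVf ?gt_eqF.
  - by rewrite -scalemxAl lamX scaler0.
case=> lam [lam0 lam1 lamS].
have /ltnW dJ : (d < #|supp lam|)%N.
  rewrite ltnNge; apply/negP => Jd; have lamE := wX _ Jd lamS; move: lam1.
  by rewrite lamE big1 => [/eqP|i _]; rewrite ?mxE // eq_sym oner_eq0.
have [B sB cB] := subset_of_card dJ.
pose f (j : 'I_d) : 'I_n := enum_val (cast_ord (esym cB) j).
have finj : injective f by move=> i j /enum_val_inj/cast_ord_inj.
have Su : rowsub f S \in unitmx by rewrite -row_free_unit walk_generic_rowsub.
(* [w] marks the zero weights; [mu] subtracts the expansion of [w *m S] in the basis selected by
   [f], whose indices all have nonzero weight. *)
pose w : 'rV[R]_n := \row_i (lam 0 i == 0)%:R.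
pose mu := w - w *m S *m invmx (rowsub f S) *m sel_mx f.
have muS : mu *m S = 0.
  by rewrite mulmxBl -(mulmxA _ (sel_mx f)) mul_sel mulmxKV // subrr.
have mu1 i : lam 0 i = 0 -> mu 0 i = 1.
  move=> li; rewrite /mu mxE mxE li eqxx mxE mul_sel_mx0 ?subr0 // => j.
  apply/eqP => fj; have := fintype.subsetP sB (f j) (enum_valP _).
  by rewrite inE fj li eqxx.
have [|e e0 He] := @all_pos_open R n [seq delta_mx i 0 | i <- enum (supp lam)] lam mu.
  apply/allP => _ /mapP[i iJ ->]; rewrite /ev -colE mxE lt_def lam0 andbT.
  by move: iJ; rewrite mem_enum inE.
apply/hitP; exists (lam + e *: mu); last by rewrite mulmxDl lamS -scalemxAl muS scaler0 addr0.
move=> i; have [li|li] := eqVneq (lam 0 i) 0.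
  by rewrite mxE [X in _ + X]mxE li mu1 // add0r mulr1.
have /He/allP/(_ (delta_mx i 0)) : `|e| <= e by rewrite gtr0_norm.
by rewrite /ev -colE mxE; apply; apply: map_f; rewrite mem_enum inE.
Qed.

(* Ordering the indices by level turns the blocks of a signed map into
   consecutive runs of steps of one signed, permuted walk. *)
Lemma smap_sort n k (c : smap n k) : onto c ->
  exists (g : smap n n) (f : 'I_k -> 'I_n), [/\ onto g, injective f &
    sum_mx k *m smx R c = rowsub f (sum_mx n *m smx R g)].
Proof.
move=> /ontoP oc.
pose lev i := if c i is Some (j, _) then nat_of_ord j else k.
(* Lexicographic order by level, then index; indices without level get level [k] and come last. *)
pose key (i : 'I_n) := (lev i * n + i)%N.
have key_inj : injective key.
  move=> i i' /(congr1 (modn^~ n)); rewrite !modnMDl !modn_small //; exact: val_inj.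
have key_lev i i' : (key i < key i')%N -> (lev i <= lev i')%N.
  apply: contraTT; rewrite -!ltnNge ltnS /key => h.
  by rewrite ltnW // (leq_trans _ (leq_addr _ _)) // -addnS (leq_trans (leq_add (leqnn _) (ltn_ord _))) // -mulSnr leq_mul.
have lev_key i i' : (lev i < lev i')%N -> (key i < key i')%N.
  by apply: contraTT; rewrite -!leqNgt leq_eqVlt => /orP[/eqP/key_inj->|/key_lev].
pose pos i := #|[set i' | (key i' < key i)%N]|.
have pos_lt i : (pos i < n)%N.
  rewrite -[X in (_ < X)%N]card_ord -cardsT proper_card // properE finset.subsetT.
  by apply/fintype.subsetPn; exists i; rewrite ?inE // ltnn.
pose p i : 'I_n := Ordinal (pos_lt i).
have pos_mono i i' : (key i < key i')%N -> (pos i < pos i')%N.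
  move=> ii; rewrite proper_card // properE; apply/andP; split.
    by apply/fintype.subsetP => x; rewrite !inE => /ltn_trans; apply.
  by apply/fintype.subsetPn; exists i; rewrite !inE ?ltnn.
have pinj : injective p.
  move=> i i' /(congr1 val) /= e; apply: key_inj.
  by case: (ltngtP (key i) (key i')) => // /pos_mono; rewrite e ltnn.
pose cnt l := #|[set i | (lev i <= l)%N]|.
have cnt_mono (l : nat) (l' : 'I_k) : (l < l')%N -> (cnt l < cnt l')%N.
  move=> ll; rewrite proper_card // properE; apply/andP; split.
    by apply/fintype.subsetP => x; rewrite !inE => /leq_trans; apply; exact: ltnW.
  have [i [e ci]] := oc l'.
  by apply/fintype.subsetPn; exists i; rewrite !inE /lev ci // -ltnNge.
have cnt0 (l : 'I_k) : (0 < cnt l)%N.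
  by have [i [e ci]] := oc l; apply/card_gt0P; exists i; rewrite inE /lev ci.
have cnt_le l : (cnt l <= n)%N by rewrite -[X in (_ <= X)%N]card_ord max_card.
(* Positions start at 0, so the last index of level at most [l] sits at position [(cnt l).-1]. *)
have f_lt (l : 'I_k) : ((cnt l).-1 < n)%N by rewrite prednK.
have posE i (l : 'I_k) : (pos i <= (cnt l).-1)%N = (lev i <= l)%N.
  rewrite -ltnS prednK //; have [il|li] := leqP (lev i) l.
    rewrite proper_card // properE; apply/andP; split.
      by apply/fintype.subsetP => x; rewrite !inE => /key_lev/leq_trans; apply.
    by apply/fintype.subsetPn; exists i; rewrite !inE ?ltnn.
  apply/negbTE; rewrite -leqNgt subset_leq_card //.
  by apply/fintype.subsetP => x; rewrite !inE => /leq_ltn_trans/(_ li)/lev_key.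
pose g : smap n n := [ffun i => Some (p i, if c i is Some (_, e) then e else false)].
exists g, (fun l => Ordinal (f_lt l)); split.
- apply/ontoP => j; exists (invF pinj j); eexists; rewrite ffunE f_invF; reflexivity.
- move=> l l' /(congr1 val) /= e; apply/val_inj.
  have {}e : cnt l = cnt l' by rewrite -(prednK (cnt0 l)) e prednK.
  by case: (ltngtP l l') => // /cnt_mono; rewrite e ltnn.
- apply/matrixP => l i; rewrite [RHS]mxE !mul_sum_smxE ffunE /= posE /lev.
  by case: (c i) => [[j e]|] //; rewrite leqNgt ltn_ord mul0r.
Qed.

(** The partial sums of a merged walk are partial sums of a rearranged walk, hence independent;
    their rank bounds that of the merged steps from below. *)
Lemma walk_generic_generic n d (X : 'M[R]_(n, d)) :
  (forall g : smap n n, onto g -> walk_generic (smx R g *m X)) -> generic X.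
Proof.
move=> H k c kd oc; have [g [f [og finj E]]] := smap_sort oc.
have := walk_generic_rowsub kd finj (H g og).
rewrite mulmxA -mul_sel mulmxA mul_sel -E -mulmxA /row_free => /eqP e.
by rewrite eqn_leq rank_leq_row -[X in (X <= _)%N]e mxrankM_maxr.
Qed.

End Walks.

(** * Measurability *)

Section ConvexHullMeasurable.
Import numFieldNormedType.Exports.
Local Open Scope classical_set_scope.
Variable R : realType.

Lemma continuous_sum (T : topologicalType) I (s : seq I) (f : I -> T -> R) :
  (forall i, continuous (f i)) -> continuous (fun x => \sum_(i <- s) f i x).
Proof.
move=> cf x; elim: s => [|i s IH].
  by under eq_fun => y do rewrite big_nil; exact: cst_continuous.
under eq_fun => y do rewrite big_cons.
by apply: (@continuousD _ _ _ (f i)) => //; exact: cf.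
Qed.

(* A closed condition on the compact simplex, replaced by countably many open
   ones with nonnegative integer weights. *)
Lemma in_conv_approx n d (p : 'I_n -> 'rV[R]_d) : in_conv p 0 <->
  forall m : nat, exists k : {ffun 'I_n -> nat}, (0 < \sum_i k i)%N /\
    forall j, m%:R * `|\sum_i (k i)%:R * p i 0 j| < (\sum_i k i)%:R.
Proof.
split.
  case=> lam [lam0 [lam1 lamp]] m.
  pose M := \sum_i \sum_j m%:R * `|p i 0 j|.
  have n1 : 0 <= n%:R :> R by [].
  have M0 : 0 <= M by apply: sumr_ge0 => i _; apply: sumr_ge0 => j _; rewrite mulr_ge0.
  (* Rounding [N * lam i] down loses less than 1 per index, so the integer weights total at least N
     - n > M, while [M] bounds [m] times the rounding error. *)
  pose N := (Num.truncn (M + n%:R + 1)).+1.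
  have NM : M + n%:R + 1 < N%:R by rewrite truncnS_gt.
  pose k : {ffun 'I_n -> nat} := [ffun i => Num.truncn (N%:R * lam i)].
  have kP i : (k i)%:R <= N%:R * lam i < (k i)%:R + 1.
    by rewrite ffunE natr1; apply: truncn_itv; rewrite mulr_ge0.
  have kN : N%:R - n%:R <= (\sum_i k i)%:R :> R.
    have -> : N%:R = \sum_i N%:R * lam i :> R by rewrite -mulr_sumr lam1 mulr1.
    have -> : n%:R = \sum_(i < n) 1 :> R by rewrite sumr_const card_ord.
    rewrite natr_sum -sumrB.
    by apply: ler_sum => i _; have /andP[_ /ltW] := kP i; rewrite lerBlDr.
  exists k; split.
    by rewrite -(ltr_nat R) (lt_le_trans _ kN) //; lra.
  move=> j; apply: (le_lt_trans (y := M)); last by apply: lt_le_trans kN; lra.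
  have -> : \sum_i (k i)%:R * p i 0 j = \sum_i ((k i)%:R - N%:R * lam i) * p i 0 j.
    have e : \sum_i lam i * p i 0 j = 0.
      have := congr1 (fun v : 'rV[R]_d => v 0 j) lamp; rewrite summxE mxE => e.
      by rewrite -[RHS]e; apply: eq_bigr => i _; rewrite mxE.
    under [RHS]eq_bigr => i _ do rewrite mulrBl -mulrA.
    by rewrite sumrB -mulr_sumr e mulr0 subr0.
  apply: (le_trans (ler_wpM2l _ (ler_norm_sum _ _ _))) => //.
  rewrite mulr_sumr; apply: ler_sum => i _.
  rewrite normrM (bigD1 j) //=; apply: ler_wpDr.
    by apply: sumr_ge0 => l _; rewrite mulr_ge0.
  rewrite ler_wpM2l // ler_piMl // distrC ger0_norm; have /andP[] := kP i; lra.
move=> H.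
(* A continuous penalty that vanishes exactly when the weights sum to 1 and represent 0; it attains
   its minimum on the cube. *)
pose g (lam : 'rV[R]_n) : R := `|\sum_i lam 0 i - 1| +
  \sum_j `|\sum_i lam 0 i * p i 0 j|.
pose B := [set lam : 'rV[R]_n | forall i, `[0, 1]%classic (lam ord0 i)].
have cB : compact B.
  by apply: (@rV_compact R n (fun=> `[0, 1]%classic)) => i; exact: segment_compact.
have cont_c i : continuous (fun lam : 'rV[R]_n => lam 0 i) by exact: coord_continuous.
have cn (f : 'rV[R]_n -> R) : continuous f -> continuous (fun x => `|f x|).
  by move=> cf x; apply: continuous_comp; [exact: cf|exact: norm_continuous].
have cl (a : 'I_n -> R) : continuous (fun lam : 'rV[R]_n => \sum_i lam 0 i * a i).
  apply: continuous_sum => i x; apply: continuousM; first exact: cont_c.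
  exact: cst_continuous.
have c1 : continuous (fun lam : 'rV[R]_n => `|\sum_i lam 0 i - 1|).
  apply: cn => y; apply: (@continuousB _ _ _ (fun lam : 'rV[R]_n => \sum_i lam 0 i)).
    by apply: continuous_sum => i; exact: cont_c.
  exact: cst_continuous.
have c2 : continuous (fun lam : 'rV[R]_n => \sum_j `|\sum_i lam 0 i * p i 0 j|).
  by apply: continuous_sum => j; apply: cn; exact: cl.
have cg : continuous g by move=> x; exact: continuousD (c1 x) (c2 x).
have [|c cB' cmin] := @compact_EVT_min _ R g B _ cB (continuous_subspaceT cg).
  by exists 0 => i /=; rewrite mxE in_itv /= lexx ler01.
have gc : g c <= 0.
  rewrite leNgt; apply/negP => g0.
  (* For this [m] the normalized integer weights have penalty at most d / m < [g c], against
     minimality. *)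
  pose m := (Num.truncn (d%:R / g c)).+1.
  have mg : d%:R / g c < m%:R by rewrite truncnS_gt.
  have [k [k0 kP]] := H m; set K := (\sum_i k i)%N in k0 kP.
  have K0 : 0 < K%:R :> R by rewrite ltr0n.
  pose lam : 'rV[R]_n := \row_i ((k i)%:R / K%:R).
  have lamB : lam \in B.
    rewrite inE => i /=; rewrite mxE in_itv /= divr_ge0 //=.
    by rewrite ler_pdivrMr // mul1r ler_nat /K (bigD1 i) //= leq_addr.
  have := cmin _ lamB; rewrite leNgt => /negP; apply.
  have -> : g lam = \sum_j `|\sum_i (k i)%:R * p i 0 j| / K%:R.
    have lam1 : \sum_i lam 0 i = 1.
      under eq_bigr => i _ do rewrite mxE.
      by rewrite -mulr_suml -natr_sum mulfV // gt_eqF.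
    rewrite /g lam1 subrr normr0 add0r; apply: eq_bigr => j _.
    under eq_bigr => i _ do rewrite mxE mulrAC.
    by rewrite -mulr_suml normrM [X in _ * X]ger0_norm // invr_ge0 ltW.
  have m0 : 0 < m%:R :> R by rewrite ltr0n.
  apply: (@le_lt_trans _ _ (\sum_(j < d) m%:R^-1)).
    apply: ler_sum => j _; rewrite ler_pdivrMr // mulrC ler_pdivlMr // mulrC.
    exact: ltW.
  rewrite sumr_const card_ord -[_ *+ d]mulr_natl ltr_pdivrMr // mulrC.
  by rewrite -ltr_pdivrMr.
have {gc} := gc; rewrite /g.
have s0 : 0 <= \sum_j `|\sum_i c 0 i * p i 0 j| by exact: sumr_ge0.
move=> gc; have [cs cp] : `|\sum_i c 0 i - 1| = 0 /\ \sum_j `|\sum_i c 0 i * p i 0 j| = 0.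
  have := normr_ge0 (\sum_i c 0 i - 1); lra.
exists (fun i => c 0 i); split; [|split].
- by move=> i; move: cB'; rewrite inE => /(_ i) /=; rewrite in_itv /= => /andP[].
- by apply/eqP; rewrite -subr_eq0 -normr_eq0 cs.
- apply/rowP => j; rewrite summxE mxE.
  move: cp => /eqP; rewrite psumr_eq0 // => /allP/(_ j); rewrite mem_index_enum.
  move=> /(_ isT); rewrite normr_eq0 => /eqP e; rewrite -[RHS]e.
  by apply: eq_bigr => i _; rewrite mxE.
Qed.

Lemma measurable_in_conv dT (T : measurableType dT) n d (p : 'I_n -> T -> 'rV[R]_d) :
  (forall i j, measurable_fun setT (fun w => p i w 0 j)) ->
  measurable [set w | in_conv (fun i => p i w) 0].
Proof.
move=> mp.
have -> : [set w | in_conv (fun i => p i w) 0] =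
  \bigcap_(m : nat) \bigcup_(k : {ffun 'I_n -> nat})
    [set w | (0 < \sum_i k i)%N && [forall j,
       m%:R * `|\sum_i (k i)%:R * p i w 0 j| < (\sum_i k i)%:R]].
  apply/seteqP; split => w /=.
    move=> /in_conv_approx H m _; have [k [k0 kP]] := H m.
    by exists k => //=; rewrite k0; apply/forallP => j; exact: kP.
  move=> H; apply/in_conv_approx => m; have [k _ /= /andP[k0 /forallP kP]] := H m I.
  by exists k.
apply: bigcapT_measurable => m; apply: countable_bigcupT_measurable => // k.
have [k0|k0] := boolP (0 < \sum_i k i)%N => /=; last first.
  by rewrite (_ : [set _ | _] = set0) //; apply/seteqP; split.
rewrite (_ : [set _ | _] = \bigcap_(j : 'I_d)
    [set w | m%:R * `|\sum_i (k i)%:R * p i w 0 j| < (\sum_i k i)%:R]); last first.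
  apply/seteqP; split => w /=; first by move=> /forallP H j _; exact: H.
  by move=> H; apply/forallP => j; exact: H.
apply: fin_bigcap_measurable => [|j _]; first exact: finite_finset.
have mf : measurable_fun setT
    (fun w => m%:R * `|\sum_i (k i)%:R * p i w 0 j| < (\sum_i k i)%:R).
  apply: measurable_fun_ltr => //; apply: measurable_funM => //.
  apply: measurableT_comp => //; apply: measurable_sum => i.
  exact: measurable_funM.
by have := mf measurableT [set true] I; rewrite setTI.
Qed.

End ConvexHullMeasurable.

(** * Random walks and exchangeability *)

Section RandomWalk.
Local Open Scope classical_set_scope.
Variable R : realType.

Lemma psum_row (T : Type) n d (x : 'I_n -> T -> 'rV[R]_d) k w :
  psum x k w = row k (sum_mx R n *m \matrix_i x i w).
Proof.
apply/rowP => j; rewrite /psum summxE mxE [RHS]mxE big_mkcond.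
by apply: eq_bigr => i _; rewrite !mxE; case: leqP; rewrite ?mul1r ?mul0r.
Qed.

Lemma psum_rowsub (T : Type) n d k (x : 'I_n -> T -> 'rV[R]_d) (f : 'I_k -> 'I_n) w :
  \matrix_i psum x (f i) w = rowsub f (sum_mx R n *m \matrix_i x i w).
Proof. by apply/row_matrixP => i; rewrite rowK psum_row row_rowsub. Qed.

Lemma in_conv_psum (T : Type) n d (x : 'I_n -> T -> 'rV[R]_d) w :
  (0 < n)%N -> walk_generic (\matrix_i x i w) ->
  in_conv (fun k => psum x k w) 0 <-> hit (\matrix_i x i w).
Proof.
move=> n0 wX; rewrite -conv_hit //; split.
  case=> lam [lam0 [lam1 lamS]]; exists (\row_i lam i); split.
  - by move=> i; rewrite mxE.
  - by rewrite -[RHS]lam1; apply: eq_bigr => i _; rewrite mxE.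
  - rewrite mulmx_sum_row -[RHS]lamS; apply: eq_bigr => i _.
    by rewrite mxE psum_row.
case=> lam [lam0 lam1 lamS]; exists (lam 0); split=> //; split=> //.
by rewrite -[RHS]lamS mulmx_sum_row; apply: eq_bigr => i _; rewrite psum_row.
Qed.

(** Level i of the product collects the single index sent there, whence the inverse permutation. *)
Lemma smx_mul_matrix n d (g : smap n n) (s : 'S_n) (b : 'I_n -> bool)
    (x : 'I_n -> 'rV[R]_d) : (forall i, g i = Some (s i, b i)) ->
  smx R g *m \matrix_i x i =
    \matrix_i ((-1) ^+ b ((s^-1)%g i) *: x ((s^-1)%g i)).
Proof.
move=> gE; apply/matrixP => j l; rewrite !mxE (bigD1 ((s^-1)%g j)) //= big1 ?addr0.
  by rewrite !mxE gE permKV eqxx.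
move=> i ij; rewrite !mxE gE; case: eqP => [e|_]; last by rewrite mul0r.
by move: ij; rewrite -e permK eqxx.
Qed.

Lemma measurable_psum dT (T : measurableType dT) n d (x : 'I_n -> T -> 'rV[R]_d) k j :
  (forall i j, measurable_fun setT (fun w => x i w 0 j)) ->
  measurable_fun setT (fun w => psum x k w 0 j).
Proof.
move=> mx; under eq_fun => w do rewrite /psum summxE big_mkcond.
by apply: measurable_sum => i; case: leqP.
Qed.

Lemma measurable_det dT (T : measurableType dT) d (M : T -> 'M[R]_d) :
  (forall i j, measurable_fun setT (fun w => M w i j)) ->
  measurable_fun setT (fun w => \det (M w)).
Proof.
move=> mM; apply: measurable_sum => s; apply: measurable_funM => //.
exact: measurable_prod.
Qed.

Lemma measurable_not_free dT (T : measurableType dT) n d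
    (x : 'I_n -> T -> 'rV[R]_d) (f : 'I_d -> 'I_n) :
  (forall i j, measurable_fun setT (fun w => x i w 0 j)) ->
  measurable [set w | ~ row_free (\matrix_k psum x (f k) w)].
Proof.
move=> mx.
have -> : [set w | ~ row_free (\matrix_k psum x (f k) w)] =
    (fun w => \det (\matrix_k psum x (f k) w)) @^-1` [set 0].
  apply/seteqP; split => w /=; rewrite row_free_unit unitmxE unitfE.
    by move=> /negP; rewrite negbK => /eqP.
  by move=> ->; rewrite eqxx.
rewrite -[X in measurable X]setTI; apply: measurable_det => // i j.
under eq_fun => w do rewrite mxE.
exact: measurable_psum.
Qed.

Section CoordinateSpace.
Import numFieldNormedType.Exports.
Variables n d : nat.

(** The space of step tuples with its coordinate maps is itself a random walk, so the general
    measurability lemmas place the events in the sigma-algebra on which [same_law] applies. *)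
Let coord_space : measurableType _ := g_sigma_algebraType (@coord_cyl R n d).

Let coord (i : 'I_n) (x : coord_space) : 'rV[R]_d := x i.

Let measurable_coord i j : measurable_fun setT (fun w => coord i w 0 j).
Proof.
move=> _ B mB; rewrite setTI; apply: sub_sigma_algebra.
by exists i, j, B.
Qed.

Lemma sigma_in_conv :
  <<s @coord_cyl R n d>> [set x | in_conv (fun k => psum (fun i (y : 'I_n -> 'rV[R]_d) => y i) k x) 0].
Proof.
apply: (@measurable_in_conv R _ coord_space n d (psum coord)) => k j.
exact: measurable_psum.
Qed.

Lemma sigma_not_free (f : 'I_d -> 'I_n) :
  <<s @coord_cyl R n d>>
    [set x | ~ row_free (\matrix_k psum (fun i (y : 'I_n -> 'rV[R]_d) => y i) (f k) x)].
Proof. exact: (@measurable_not_free _ coord_space n d coord f). Qed.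

End CoordinateSpace.

Variables (dT : measure_display) (T : measurableType dT) (P : probability T R).
Variables (d n : nat) (xi : 'I_n -> T -> 'rV[R]_d).
Hypotheses (dn : (d <= n)%N) (n0 : (0 < n)%N).
Hypothesis mxi : forall i j, measurable_fun setT (fun w => xi i w 0 j).
Hypothesis sxi : sym_exchangeable P xi.
Hypothesis fxi : forall f : 'I_d -> 'I_n, injective f ->
  {ae P, forall w, row_free (\matrix_(k < d) psum xi (f k) w)}.

Let X w : 'M[R]_(n, d) := \matrix_i xi i w.

Let Y (g : smap n n) i w : 'rV[R]_d := row i (smx R g *m X w).

Let mY g i j : measurable_fun setT (fun w => Y g i w 0 j).
Proof.
under eq_fun => w do rewrite mxE mxE.
apply: measurable_sum => k; apply: measurable_funM => //.
under eq_fun => w do rewrite mxE.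
exact: mxi.
Qed.

Let lawY g : onto g -> same_law P xi (Y g).
Proof.
move=> /onto_perm[s [b gE]].
rewrite (_ : Y g = fun i w => (-1) ^+ b ((s^-1)%g i) *: xi ((s^-1)%g i) w); last first.
  by apply/funext => i; apply/funext => w; rewrite /Y (smx_mul_matrix _ gE) rowK.
exact: sxi (s^-1)%g (fun i => b ((s^-1)%g i)).
Qed.

Let matY g w : \matrix_i Y g i w = smx R g *m X w.
Proof. by apply/row_matrixP => i; rewrite rowK. Qed.

(** Each rearranged walk has the law of the original one, so its exceptional sets are null, and
    there are finitely many pairs of [g] and [f]. *)
Lemma ae_walk_generic :
  {ae P, forall w, forall g : smap n n, onto g -> walk_generic (smx R g *m X w)}.
Proof.
have H (g : smap n n) (f : {ffun 'I_d -> 'I_n}) : onto g -> injective f ->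
    {ae P, forall w, row_free (\matrix_(k < d) psum (Y g) (f k) w)}.
  move=> og finj; apply: (proj2 (negligibleP _ (measurable_not_free f (mY g)))).
  have := lawY og (sigma_not_free f) => /= <-.
  by have /negligibleP := fxi finj; apply; exact: measurable_not_free.
have H' : {ae P, forall w, forall (g : smap n n) (f : {ffun 'I_d -> 'I_n}),
    onto g -> injective f -> row_free (\matrix_(k < d) psum (Y g) (f k) w)}.
  apply: filter_forall => g; apply: filter_forall => f.
  have [og|nog] := boolP (onto g); last by apply: nearW => w.
  have [finj|nf] := pselect (injective f); last by apply: nearW => w.
  by apply: filterS (H g f og finj) => w.
apply: filterS H' => w Hw g og; apply: walk_genericI => // f finj.
have finj' : injective (finfun f) by move=> i j; rewrite !ffunE => /finj.
have := Hw g (finfun f) og finj'; rewrite psum_rowsub matY.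
by congr (row_free _); apply/matrixP => i j; rewrite !mxE ffunE.
Qed.

(** All rearranged walks have equal probability, so the left side is the expected number of
    rearrangements whose hull contains 0; that number is almost surely constant by [num_hitE]. *)
Lemma sum_probability_in_conv :
  ((num_onto n n)%:R%:E * P [set w | in_conv (fun k => psum xi k w) 0] =
  (tail_Bcoef d n)%:~R%:E)%E.
Proof.
pose E (g : smap n n) := [set w | in_conv (fun k => psum (Y g) k w) 0].
have mE g : measurable (E g).
  by apply: (measurable_in_conv (p := psum (Y g))) => k j; exact: measurable_psum.
have PE g : onto g -> P (E g) = P [set w | in_conv (fun k => psum xi k w) 0].
  by move=> og; have := lawY og (@sigma_in_conv n d).
transitivity (\sum_(g : smap n n | onto g) P (E g))%E.
  rewrite (eq_bigr _ PE) -(fineK (fin_num_measure P _ _)); last first.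
    by apply: (measurable_in_conv (p := psum xi)) => k j; exact: measurable_psum.
  by rewrite sumEFin sumr_const -EFinM mulr_natl.
have -> : (\sum_(g : smap n n | onto g) P (E g) =
    \sum_(g : smap n n | onto g) \int[P]_w (\1_(E g) w)%:E)%E.
  by apply: eq_bigr => g _; rewrite integral_indic // setIT.
rewrite -big_filter -ge0_integral_sum //; last first.
  by move=> g; apply/measurable_EFinP; exact: measurable_indic.
transitivity (\int[P]_w (cst (tail_Bcoef d n)%:~R%:E w))%E; last first.
  rewrite integral_cst // -[RHS]mule1; congr (_ * _)%E.
  exact: probability_setT.
apply: ae_eq_integral => //.
  apply: emeasurable_sum => g; apply/measurable_EFinP; exact: measurable_indic.
apply: filterS ae_walk_generic => w Hw _.
rewrite big_filter sumEFin /=; congr (_%:E).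
rewrite -(num_hitE n0 (walk_generic_generic Hw)) /num_hit rmorph_sum /=.
apply: eq_bigr => g og; rewrite indicE rmorph_nat; congr (nat_of_bool _)%:R.
have := in_conv_psum (x := Y g) (w := w) n0; rewrite matY => /(_ (Hw g og)) h.
by apply/idP/idP; rewrite inE => /h.
Qed.

End RandomWalk.

Local Open Scope classical_set_scope.
Local Open Scope ring_scope.

Theorem theorem2p3 (dT : measure_display) (T : measurableType dT) (R : realType)
    (P : probability T R) (d n : nat) (xi : 'I_n -> T -> 'rV[R]_d) :
  (1 <= d)%N -> (d <= n)%N ->
  (forall (i : 'I_n) (j : 'I_d), measurable_fun setT (fun w => xi i w 0 j)) ->
  sym_exchangeable P xi ->
  (forall f : 'I_d -> 'I_n, injective f ->
     {ae P, forall w, row_free (\matrix_(k < d) psum xi (f k) w)}) ->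
  P [set w | in_conv (fun k => psum xi k w) 0] =
    ((2 * \sum_(k < n.+1 | (d < k)%N && odd (k - d)) Bcoef n k)%:~R
       / ((2 ^ n * n`!)%N)%:R)%:E.
Proof.
move=> d0 dn mxi sxi fxi; have n0 := leq_trans d0 dn.
have := sum_probability_in_conv dn n0 mxi sxi fxi.
have -> : num_onto n n = (2 ^ n * n`!)%N.
  by apply/eqP; rewrite -(eqr_nat rat) num_onto_diag.
rewrite -(fineK (fin_num_measure P _ _)); last first.
  by apply: (measurable_in_conv (p := psum xi)) => k j; exact: measurable_psum.
rewrite -EFinM => -[]; rewrite -/(tail_Bcoef d n) => <-.
by rewrite mulrC mulKf // pnatr_eq0 muln_eq0 expn_eq0 /= -lt0n fact_gt0.
Qed.
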